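(* Let $X_1,\dots,X_n$ be i.i.d. real random variables whose common distribution is symmetric about $\mu\in\mathbb{R}$ and satisfies $\mathbb{E}\big[|X_1-\mathbb{E}X_1|^{1+a}\big]=M<\infty$ for some $a\in(0,1]$. Let $1\le r\le m$ be integers, $k\le n$ an integer, $\tilde n=\lfloor n/k\rfloor$, let $R(\theta)$ be the one-sided resampled median-of-means rank defined in the context, $\Theta_n=\{\theta: R(\theta)\le m-r\}$ and $U=\sup\Theta_n$. Then $$\mathbb{P}\Big(U-\mu>4\Big(\frac{(12M)^{1/a}}{\tilde n}\Big)^{\frac{a}{1+a}}\Big)\le (m-r)\big(2k\exp(-\tilde n/8)+2\exp(-k/8)\big).$$
   Context: Blocks: for $\ell=1,\dots,k$ let $B_\ell=\{i\in[n]: i\equiv \ell \pmod k\}$. Median: for reals $y_1,\dots,y_k$ with order statistics $y_{(1)}\le\dots\le y_{(k)}$, $\mathrm{med}(y_1,\dots,y_k)=y_{(k/2)}$ if $k$ is even and $y_{(\lfloor k/2\rfloor+1)}$ if $k$ is odd. Median-of-means: $\widehat\mu(x_1,\dots,x_n)=\mathrm{med}\big(\frac{1}{|B_1|}\sum_{i\in B_1}x_i,\dots,\frac{1}{|B_k|}\sum_{i\in B_k}x_i\big)$. Randomization: $\{\alpha_{i,j}\}_{i\in[n],j\in[m-1]}$ i.i.d. Rademacher signs independent of the data; $\pi$ a uniformly random permutation of $\{0,\dots,m-1\}$ independent of data and signs. For $\theta\in\mathbb{R}$: $\mathcal{D}_0(\theta)=(X_1,\dots,X_n)$, $\mathcal{D}_j(\theta)=(\alpha_{1,j}(X_1-\theta)+\theta,\dots,\alpha_{n,j}(X_n-\theta)+\theta)$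 for $j\in[m-1]$ (same signs for all $\theta$); $S_j(\theta)=\widehat\mu(\mathcal{D}_j(\theta))-\theta$ for $j=0,\dots,m-1$. $S_j(\theta)\prec_\pi S_l(\theta)$ iff $S_j(\theta)<S_l(\theta)$, or $S_j(\theta)=S_l(\theta)$ and $\pi(j)<\pi(l)$. $R(\theta)=1+\sum_{j=1}^{m-1}\mathbb{I}\big(S_0(\theta)\prec_\pi S_j(\theta)\big)$. The supremum of the empty set is $-\infty$. *)

(* Defs.v *)
From HB Require Import structures.
From mathcomp Require Import all_boot all_order all_algebra all_fingroup.
From mathcomp Require Import all_classical all_reals all_analysis.
Set Implicit Arguments. Unset Strict Implicit. Unset Printing Implicit Defensive.
Import Order.TTheory GRing.Theory Num.Theory.
Local Open Scope ring_scope.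

Section MoM.
Variable R : realType.

(* median: y_(k/2) (k even) or y_(floor(k/2)+1) (k odd), 1-based order
   statistics; here translated to 0-based indices in the sorted list. *)
Definition median (s : seq R) : R :=
  let k := size s in
  nth 0 (sort <=%R s) (if odd k then k./2 else k./2 - 1)%N.

(* block B_l (paper, 1-based: i = l mod k) = {i : 'I_n | i mod k = l} in
   0-based indexing (paper i = our i+1, paper l = our l+1). *)
Definition block n k (l : 'I_k) : {set 'I_n} := [set i : 'I_n | (i %% k == l)%N].

Definition block_mean n k (x : 'I_n -> R) (l : 'I_k) : R :=
  (\sum_(i in block n l) x i) / #|block n l|%:R.

Definition median_of_means n k (x : 'I_n -> R) : R :=
  median [seq block_mean x l | l <- enum 'I_k].

(* pi as a function on nat (only its values on 0..m-1 are used) *)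
Definition perm_nat m (p : {perm 'I_m}) (x : nat) : nat :=
  match (insub x : option 'I_m) with Some o => val (p o) | None => x end.

Definition resampled n (x : 'I_n -> R) (alpha : 'I_n -> nat -> bool)
  (theta : R) (j : nat) : 'I_n -> R :=
  fun i => if j == 0%N then x i
           else (if alpha i j then 1 else -1) * (x i - theta) + theta.

Definition Sstat n k (x : 'I_n -> R) (alpha : 'I_n -> nat -> bool)
  (theta : R) (j : nat) : R :=
  median_of_means k (resampled x alpha theta j) - theta.

Definition prec_pi (S : nat -> R) (pi : nat -> nat) (j l : nat) : bool :=
  (S j < S l) || ((S j == S l) && (pi j < pi l)%N).

Definition rankR n k m (x : 'I_n -> R) (alpha : 'I_n -> nat -> bool)
  (p : {perm 'I_m}) (theta : R) : nat :=
  (1 + \sum_(1 <= j < m) prec_pi (Sstat k x alpha theta) (perm_nat p) 0 j)%N.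

(* U = sup {theta : R(theta) <= m - r}, sup of empty set = -oo *)
Definition upper_bound n k m r (x : 'I_n -> R) (alpha : 'I_n -> nat -> bool)
  (p : {perm 'I_m}) : \bar R :=
  ereal_sup [set theta%:E | theta in [set theta | (rankR k x alpha p theta <= m - r)%N]].

End MoM.

(* Main.v *)
(** Put [Y = X - mu], [s = thr / 4] where [thr] is the deviation in the theorem,
and condition on the finitely many values of the signs and of the permutation.
If [R(theta) <= m - r], one of the first [m - r] copies has
[S_j(theta) <= S_0(theta)].  For [theta > mu + 4 s] this forces one of:
some block average of the signs of copy [j] exceeds [1/2] in absolute value;
at least half of the block means of [Y] exceed [s]; at least half of the block
means of the sign-flipped [Y] lie below [-s].

The first event is bounded by counting sign vectors.  For the other two, give
each block a random sign [tau_l] and let [f_tau(y)] be [exp (tau y / b)] if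
[|y| <= b] and [3/2] otherwise, with [b = N_l s].  By [cosh >= 1], the average
over [tau_l] of the product of [f] over block [l] is at least [1], and at least
[3/2 >= exp (2/5)] if the block sum exceeds [b].  By symmetry of [Y],
[E f_tau(Y) <= 1 + 3 / (40 N_l)], so that independence of the individual
observations gives the bound [exp (- k/5 + 3k/40) = exp (- k/8)].

The event itself is an uncountable union over [theta]; its measurability
follows from the Lipschitz dependence of the [S_j] on [theta]. *)

Require Import Defs.
From HB Require Import structures.
From mathcomp Require Import all_boot all_order all_algebra all_fingroup.
From mathcomp Require Import all_classical all_reals all_analysis.
From mathcomp Require Import measurable_realfun zify ring lra.
Import Order.TTheory GRing.Theory Num.Theory.
Local Open Scope classical_set_scope.
Local Open Scope ring_scope.
Set Implicit Arguments. Unset Strict Implicit. Unset Printing Implicit Defensive.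

(** * Order statistics *)

Section Median.
Variable R : realType.
Implicit Types (s : seq R) (t e : R).

(** The entries at most [t] form a prefix of a sorted list, so entry [i] is one of them exactly when
    this prefix is longer than [i]. *)
Lemma sorted_nth_le s i t : sorted <=%R s -> (i < size s)%N ->
  (nth 0 s i <= t) = (i < count (fun y : R => (y <= t)%R) s)%N.
Proof.
elim: s i => [//|x s IH] i /= pxs.
have xs : all (fun y => x <= y) s by exact: order_path_min le_trans pxs.
have ss : sorted <=%R s := path_sorted pxs.
have [xt|tx] := leP x t; case: i => [|i] //= isz; rewrite ?add0n ?add1n ?ltnS.
- exact: IH.
- rewrite lt_geF//; apply/esym/negbTE; rewrite -leqNgt leqn0 -leqn0 leqNgt -has_count.
  by apply/hasPn => y ys; rewrite -ltNge (lt_le_trans tx)// (allP xs).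
- rewrite [RHS](_ : _ = false) ?lt_geF//.
    by rewrite (lt_le_trans tx)// (allP xs)// mem_nth.
  apply/negbTE; rewrite -leqNgt (@leq_trans 0)// leqNgt -has_count.
  by apply/hasPn => y ys; rewrite -ltNge (lt_le_trans tx)// (allP xs).
Qed.

(** For [k > 0] both branches are the integer part of [(k - 1) / 2]: the lower median, counted from
    [0]. *)
Definition median_index k := (if odd k then k./2 else k./2 - 1)%N.

(** Turns comparisons with the median into counts, so that sorting does not appear again. *)
Lemma median_le k (y : 'I_k -> R) t : (0 < k)%N ->
  (median [seq y l | l <- enum 'I_k] <= t)
    = (median_index k < #|[set l | (y l <= t)%R]%SET|)%N.
Proof.
move=> k0; rewrite /median size_map size_enum_ord -/(median_index k).
rewrite sorted_nth_le ?sort_sorted//; last first.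
- rewrite size_sort size_map size_enum_ord /median_index.
  by case: ifP => ok; lia.
- exact: le_total.
rewrite (seq.permP (permEl (perm_sort _ _))) count_map.
by rewrite cardsE cardE /enum_mem size_filter; congr (_ < _)%N; rewrite filter_predT.
Qed.

Lemma card_gt_median k (y : 'I_k -> R) t : (0 < k)%N ->
  t < median [seq y l | l <- enum 'I_k] -> (k <= 2 * #|[set l | (t < y l)%R]%SET|)%N.
Proof.
move=> k0; rewrite ltNge median_le// -leqNgt => h.
have := cardsC [set l | (y l <= t)%R]%SET; rewrite card_ord.
rewrite (_ : (~: _)%SET = [set l | (t < y l)%R]%SET); last first.
  by apply/setP => l; rewrite !inE ltNge.
by move: h; rewrite /median_index; case: ifP => ok; lia.
Qed.

Lemma card_lt_median k (y : 'I_k -> R) t : (0 < k)%N ->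
  median [seq y l | l <- enum 'I_k] < t -> (k <= 2 * #|[set l | (y l < t)%R]%SET|)%N.
Proof.
move=> k0 yt; have := lexx (median [seq y l | l <- enum 'I_k]).
rewrite median_le// => h.
suff : (#|[set l | (y l <= median [seq y l | l <- enum 'I_k])%R]%SET|
         <= #|[set l | (y l < t)%R]%SET|)%N.
  by move: h; rewrite /median_index; case: ifP => ok; lia.
by apply: subset_leq_card; apply/fintype.subsetP => l; rewrite !inE => /le_lt_trans; exact.
Qed.

(** Wherever [z l] is at most the median of [z], [y l] is at most that median plus [e], so the count
    for [y] is no smaller. Both the translation rule and the Lipschitz bound in [theta] come from
    this. *)
Lemma median_leD k (y z : 'I_k -> R) e : (0 < k)%N -> (forall l, y l <= z l + e) ->
  median [seq y l | l <- enum 'I_k] <= median [seq z l | l <- enum 'I_k] + e.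
Proof.
move=> k0 yz; rewrite median_le//.
have := lexx (median [seq z l | l <- enum 'I_k]); rewrite median_le// => /leq_trans; apply.
apply: subset_leq_card; apply/fintype.subsetP => l; rewrite !inE => h.
by rewrite (le_trans (yz l))// lerD2r.
Qed.

End Median.

(** * The rank statistics and the deterministic part of the argument *)

Section Resampling.
Variable R : realType.
Variables n k : nat.
Hypothesis kn : (0 < k <= n)%N.
Implicit Types (x : 'I_n -> R) (al : 'I_n -> nat -> bool) (e mu s theta : R) (l : 'I_k).

Definition sgb (b : bool) : R := if b then 1 else -1.

Lemma sgb_norm b : `|sgb b| = 1.
Proof. by case: b; rewrite /sgb ?normrN normr1. Qed.

(* Index [0] stands for the original data, i.e. all signs equal to [1]. *)
Definition resign al (j : nat) i := sgb ((j == 0%N) || al i j).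

Lemma k_gt0 : (0 < k)%N. Proof. by case/andP: kn. Qed.

(** The indices [q * k + l] with [q < n %/ k] are distinct, lie below [n] and have residue [l]. *)
Lemma block_card l : (n %/ k <= #|block n l|)%N.
Proof.
have [k0 _] := andP kn.
have h (q : 'I_(n %/ k)) : (q * k + l < n)%N.
  have := leq_divM n k; have := ltn_ord q; have := ltn_ord l.
  by move=> hl hq; apply: leq_trans; rewrite (@leq_trans (q.+1 * k))// ?leq_mul2r ?hq ?orbT// mulSn; lia.
pose f q := Ordinal (h q).
have fi : injective f.
  move=> q q' /(congr1 val) /= /eqP; rewrite eqn_add2r eqn_pmul2r// => /eqP.
  exact: val_inj.
rewrite -[X in (X <= _)%N]card_ord -(card_imset _ fi) subset_leq_card//.
apply/fintype.subsetP => _ /imsetP[q _ ->]; rewrite inE /=.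
by rewrite modnMDl modn_small.
Qed.

Lemma block_card_gt0 l : 0 < #|block n l|%:R :> R.
Proof.
have [k0 le_kn] := andP kn; rewrite ltr0n (leq_trans _ (block_card l))//.
by rewrite divn_gt0.
Qed.

(** The shift by [theta] passes through the means of the nonempty blocks and through the median, and
    cancels the final [- theta]. *)
Lemma Sstat_median x al theta j : Sstat k x al theta j =
  median [seq (\sum_(i in block n l) resign al j i * (x i - theta)) / #|block n l|%:R
         | l <- enum 'I_k].
Proof.
have k0 := k_gt0.
have E l : block_mean (resampled x al theta j) l =
    (\sum_(i in block n l) resign al j i * (x i - theta)) / #|block n l|%:R + theta.
  rewrite /block_mean; have N0 := block_card_gt0 l.
  rewrite -[X in _ = _ + X](mulfK (lt0r_neq0 N0) theta) -mulrDl; congr (_ / _).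
  rewrite mulr_natr -sumr_const -big_split/=.
  apply: eq_bigr => i _; rewrite /resampled /resign /sgb.
  by case: (j == 0%N) => /=; rewrite ?mul1r ?subrK.
rewrite /Sstat /median_of_means; apply/eqP; rewrite subr_eq; apply/eqP/le_anti/andP; split.
  by apply: median_leD => // l; rewrite E.
by rewrite -lerBrDr; apply: median_leD => // l; rewrite E addrK.
Qed.

Lemma Sstat_lipschitz x al j theta theta' :
  Sstat k x al theta j <= Sstat k x al theta' j + `|theta - theta'|.
Proof.
rewrite !Sstat_median; apply: median_leD => [|l]; first exact: k_gt0.
have N0 := block_card_gt0 l.
rewrite ler_pdivrMr// mulrDl divfK ?gt_eqF// -lerBlDl -sumrB.
rewrite mulr_natr -sumr_const ler_sum// => i _.
rewrite -mulrBr (_ : _ - theta - _ = theta' - theta); last by ring.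
by rewrite (le_trans (ler_norm _))// normrM sgb_norm mul1r distrC.
Qed.

(** If [S_0 > mu + s - theta], half of the block means of [x - mu] exceed [s]. Otherwise [S_j] is at
    most [mu + s - theta] too, and since balanced signs shrink the shift [mu - theta] to at most
    half its size, the signed noise has to account for the rest. *)
Lemma Sstat_le_blocks x al j mu s theta : 0 <= s -> mu + 4 * s < theta ->
  (forall l, `|\sum_(i in block n l) resign al j i| <= #|block n l|%:R / 2) ->
  Sstat k x al theta j <= Sstat k x al theta 0 ->
  (k <= 2 * #|[set l : 'I_k | (#|block n l|%:R * s < \sum_(i in block n l) (x i - mu))%R]%SET|)%N \/
  (k <= 2 * #|[set l : 'I_k | (#|block n l|%:R * s
                < \sum_(i in block n l) - resign al j i * (x i - mu))%R]%SET|)%N.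
Proof.
move=> s0 th hal; rewrite !Sstat_median => hS; have k0 := k_gt0.
pose S0 := median [seq (\sum_(i in block n l) resign al 0 i * (x i - theta)) / #|block n l|%:R | l <- enum 'I_k].
have [h|h] := ltP (mu + s - theta) S0; [left|right].
  apply: leq_trans (card_gt_median k0 h) _; rewrite leq_mul2l /=.
  apply: subset_leq_card; apply/fintype.subsetP => l; rewrite !inE.
  have N0 := block_card_gt0 l; rewrite ltr_pdivlMr//.
  rewrite (eq_bigr (fun i => (x i - mu) + (mu - theta))); last first.
    by move=> i _; rewrite /resign eqxx /sgb /=; ring.
  by rewrite big_split/= sumr_const -[_ *+ _]mulr_natr; lra.
have {}h := le_lt_trans (le_trans hS h).
(* The factor [4] enters here: this inequality is equivalent to [theta - mu > 4 s]. *)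
have h1 : mu + s - theta < - s - (theta - mu) / 2 by lra.
apply: leq_trans (card_lt_median k0 (h _ h1)) _; rewrite leq_mul2l /=.
apply: subset_leq_card; apply/fintype.subsetP => l; rewrite !inE.
have N0 := block_card_gt0 l; rewrite ltr_pdivrMr//.
rewrite (eq_bigr (fun i => - (- resign al j i * (x i - mu)) + resign al j i * (mu - theta))); last first.
  by move=> i _; ring.
rewrite big_split/= sumrN -mulr_suml => hlt.
have : `|(\sum_(i in block n l) resign al j i) * (mu - theta)| <= #|block n l|%:R / 2 * (theta - mu).
  rewrite normrM ler_pM//; by rewrite ler_norml; apply/andP; split; lra.
rewrite ler_norml => /andP[hl _].
have E : (- s - (theta - mu) / 2) * #|block n l|%:R
    = - (#|block n l|%:R * s) - #|block n l|%:R / 2 * (theta - mu) by field.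
by rewrite E in hlt; lra.
Qed.

(** Pigeonhole: the rank is one more than the number of copies above the original, so at most
    [J - 1] copies are above it and one of the first [J] is not. With [J = m - r] this produces the
    factor [m - r] of the theorem. *)
Lemma rankR_ge x al m (p : {perm 'I_m.+1}) theta (J : nat) : (J <= m)%N ->
  (rankR k x al p theta <= J)%N ->
  exists2 j : 'I_m, (j < J)%N & ~~ prec_pi (Sstat k x al theta) (perm_nat p) 0 j.+1.
Proof.
move=> Jm; rewrite /rankR add1n big_add1 big_mkord /= => h.
apply/exists_inP; apply/contraT => /exists_inPn hn.
have {}hn : forall j : 'I_m, (j < J)%N -> prec_pi (Sstat k x al theta) (perm_nat p) 0 j.+1.
  by move=> j jJ; move: (hn j jJ); rewrite negbK.
suff : (J <= \sum_(i < m) prec_pi (Sstat k x al theta) (perm_nat p) 0 i.+1)%N.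
  by move=> hJ; have := leq_trans h hJ; rewrite ltnn.
rewrite -[X in (X <= _)%N]card_ord -sum1_card.
rewrite (big_ord_widen m (fun=> 1)%N Jm) [leqRHS](bigID (fun i : 'I_m => (i < J)%N)) /=.
rewrite -[leqLHS]addn0 leq_add// leq_sum// => i iJ.
by rewrite hn.
Qed.

End Resampling.

(** * Truncated exponentials *)

Section ExponentialBounds.
Variable R : realType.
Implicit Types (b y z : R) (tau c : bool).

(** This power of [1 + z <= exp z] reduces numerical estimates of the exponential to rational
    arithmetic. *)
Lemma expR_natM_ge (z : R) n : -1 <= z -> (1 + z) ^+ n <= expR (n%:R * z).
Proof.
move=> z1; rewrite mulrC expRM_natr lerXn2r ?nnegrE ?expR_ge0 ?expR_ge1Dx//; lra.
Qed.

Lemma expR_1_ge : 21/8 <= expR 1 :> R.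
Proof.
have := @expR_natM_ge (1/16) 16; rewrite (_ : 16%:R * (1 / 16) = 1); last by field.
by move=> h; apply: le_trans (h _); lra.
Qed.

Lemma expR_2_5_le : expR (2/5) <= 3/2 :> R.
Proof.
have := @expR_natM_ge (-1/40) 16; rewrite (_ : 16%:R * (-1 / 40) = - (2/5)); last by field.
move=> h; have {}h : 2/3 <= expR (- (2/5)) :> R by apply: le_trans (h _); lra.
by move: h; rewrite expRN => h; rewrite -[leLHS]invrK -[leRHS]invrK lef_pV2 ?posrE ?invr_gt0 ?expR_gt0//; lra.
Qed.

Lemma expR_N1_8_ge : 337/384 <= expR (- (1/8)) :> R.
Proof.
have := @expR_natM_ge (-1/16) 2; rewrite (_ : 2%:R * (-1 / 16) = - (1/8)); last by field.
by move=> h; apply: le_trans (h _); lra.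
Qed.

Lemma expRDN_ge2 z : 2 <= expR z + expR (- z).
Proof. have := expR_gt0 z; rewrite expRN => e0; rewrite -subr_ge0.
rewrite (_ : _ - 2 = (expR z - 1) ^+ 2 / expR z); last by field; rewrite gt_eqF.
by rewrite divr_ge0 ?sqr_ge0 ?ltW.
Qed.

(** With [e = exp z >= 21/8], the quantity [e^2 - 3 e + 1 = (e - 21/8) (e - 3/8) + 1/64] is
    positive. *)
Lemma expRDN_ge3 z : 1 <= z -> 3 <= expR z + expR (- z).
Proof.
move=> z1; have e1 : 21/8 <= expR z by rewrite (le_trans expR_1_ge)// ler_expR.
have e0 := expR_gt0 z; rewrite expRN -subr_ge0.
rewrite (_ : _ - 3 = ((expR z - 21/8) * (expR z - 3/8) + 1/64) / expR z); last by field; rewrite gt_eqF.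
by rewrite divr_ge0 ?ltW// ltr_wpDl// mulr_ge0; lra.
Qed.

(** With [h = z / 2] and [d = exp h - exp (- h)], the left side is [2 + d^2]. For [0 <= h <= 1/2],
    linear bounds on both exponentials give [d <= 13/5 h], and [(13/5)^2 / 4 < 9/5]. *)
Lemma expRDN_le z : `|z| <= 1 -> expR z + expR (- z) <= 2 + 9/5 * z ^+ 2.
Proof.
wlog z0 : z / 0 <= z => [H|].
  have [z0|z0 z1] := leP 0 z; first exact: H.
  have := H (- z); rewrite opprK sqrrN normrN [expR _ + _]addrC; apply => //; lra.
rewrite ger0_norm// => z1; pose h := z / 2.
have -> : z = h + h by rewrite /h; lra.
have h0 : 0 <= h by rewrite /h; lra.
have h1 : h <= 1/2 by rewrite /h; lra.
have eN : 1 - h <= expR (- h) by exact: expR_ge1Dx.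
have eP : expR h <= 1 + 8/5 * h.
  have q0 : 0 < (1 - h/2) ^+ 2 by rewrite exprn_gt0//; lra.
  have : (1 - h/2) ^+ 2 <= expR (- h).
    have := @expR_natM_ge (- h / 2) 2; rewrite (_ : 2%:R * (- h / 2) = - h); last by field.
    by rewrite mulNr; apply; lra.
  rewrite expRN => hq; have e0 := expR_gt0 h.
  have : (1 - h/2) ^+ 2 * expR h <= 1 by rewrite -ler_pdivlMr// div1r.
  move=> hh; rewrite -(ler_pM2l q0) (le_trans hh)//; nra.
have mono : expR (- h) <= expR h by rewrite ler_expR; lra.
have d0 : 0 <= expR h - expR (- h) <= 13/5 * h by lra.
have E1 : expR h * expR (- h) = 1 by rewrite -expRD subrr expR0.
rewrite opprD !expRD; nra.
Qed.

(* For [b = 0] the quotient [y / b] is [0], so this is [1] at [y = 0] and [3/2] elsewhere. *)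
Definition trunc_exp tau b y : R :=
  if `|y| <= b then expR (sgb R tau * (y / b)) else 3/2.

Lemma trunc_exp_gt0 tau b y : 0 < trunc_exp tau b y.
Proof. by rewrite /trunc_exp; case: ifP => _; rewrite ?expR_gt0//; lra. Qed.

(** A sign on the argument amounts to a change of [tau]; so resampling signs do not affect the
    moment bounds, and symmetry of the law exchanges the two values of [tau]. *)
Lemma trunc_exp_sgb tau c b y : trunc_exp tau b (sgb R c * y) = trunc_exp (tau == c) b y.
Proof.
rewrite /trunc_exp normrM sgb_norm mul1r; case: ifP => // _; congr expR.
by case: tau c => -[] /=; rewrite /sgb; ring.
Qed.

Lemma trunc_expD_le b y : 0 <= b -> `|y| <= b ->
  trunc_exp true b y + trunc_exp false b y <= 2 + 9/5 * (y / b) ^+ 2.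
Proof.
move=> b0 yb; rewrite /trunc_exp yb /sgb mul1r mulN1r expRDN_le//.
have [->|bN0] := eqVneq b 0; first by rewrite invr0 mulr0 normr0 ler01.
have {bN0}b0 : 0 < b by rewrite lt_neqAle eq_sym bN0.
by rewrite normrM normfV (gtr0_norm b0) ler_pdivrMr// mul1r.
Qed.

Lemma measurable_trunc_exp tau b : measurable_fun setT (trunc_exp tau b).
Proof.
apply: measurable_fun_if => //.
- apply: measurable_fun_ler => //; exact: measurable_normr.
- apply: measurableT_comp => //=; apply: measurable_funTS.
  apply: measurable_funM => //; exact: measurable_funM.
Qed.

(** Large entries give a factor [3/2] each and the others add up in the exponent; the average over
    [tau] is then a power of [3/2] times a hyperbolic cosine. *)
Lemma prod_trunc_exp (I : finType) (B : {set I}) (y : I -> R) tau b :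
  \prod_(i in B) trunc_exp tau b (y i) =
  (3/2) ^+ #|[set i in B | (b < `|y i|)%R]%SET|
   * expR (sgb R tau * \sum_(i in B | `|y i| <= b) (y i / b)).
Proof.
rewrite (bigID (fun i => `|y i| <= b)) /= mulrC mulr_sumr expR_sum; congr (_ * _).
  rewrite -prodr_const; apply: eq_big => [i|i /andP[_]]; first by rewrite !inE ltNge.
  by rewrite /trunc_exp => /negbTE ->.
by apply: eq_bigr => i /andP[_ h]; rewrite /trunc_exp h.
Qed.

Lemma prod_trunc_expD_ge (I : finType) (B : {set I}) (y : I -> R) b :
  1 <= (\prod_(i in B) trunc_exp true b (y i) + \prod_(i in B) trunc_exp false b (y i)) / 2.
Proof.
rewrite !prod_trunc_exp -mulrDr /sgb mul1r mulN1r.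
set S := \sum_(i in B | _) _; set K := _ ^+ _.
have K1 : 1 <= K by rewrite exprn_ege1//; lra.
have := expRDN_ge2 S; nra.
Qed.

(** One large entry already gives a factor [3/2]. Without large entries the exponent is the full sum
    divided by [b], which exceeds [1], and [expRDN_ge3] applies. *)
Lemma prod_trunc_expD_gt (I : finType) (B : {set I}) (y : I -> R) b :
  0 <= b -> b < \sum_(i in B) y i -> 3/2 <=
  (\prod_(i in B) trunc_exp true b (y i) + \prod_(i in B) trunc_exp false b (y i)) / 2.
Proof.
move=> b0 by_; rewrite !prod_trunc_exp -mulrDr /sgb mul1r mulN1r.
have [/finset.set0Pn[j jB]|] := boolP ([set i in B | (b < `|y i|)%R]%SET != finset.set0).
  set S := \sum_(i in B | _) _; set K := _ ^+ _.
  have K1 : 3/2 <= K.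
    rewrite /K (cardD1 j) jB exprS -[leLHS]mulr1 ler_pM2l; last lra.
    by rewrite exprn_ege1//; lra.
  have := expRDN_ge2 S; nra.
rewrite negbK => /eqP B0; rewrite B0 cards0 expr0 mul1r.
have Bb i : i \in B -> `|y i| <= b.
  by move=> iB; rewrite leNgt; apply/negP => h; have := finset.in_set0 i; rewrite -B0 !inE iB h.
rewrite (eq_bigl (mem B)); last by move=> i /=; case: (boolP (i \in B)) => //= /Bb.
rewrite -mulr_suml; suff : 1 <= (\sum_(i in B) y i) / b by move=> /expRDN_ge3; lra.
have bp : 0 < b.
  rewrite lt_neqAle b0 andbT eq_sym; apply: contraTneq by_ => b00.
  rewrite b00 big1 ?ltxx// => i /Bb; rewrite b00 normr_le0 => /eqP //.
by rewrite ler_pdivlMr// mul1r ltW.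
Qed.

End ExponentialBounds.

(** * Expectation of products *)

Section EqualLaws.
Local Open Scope ereal_scope.
Import HBNNSimple.
Context d (T : measurableType d) (R : realType) (P : probability T R).

Let measurable_preim (Z : T -> R) (B : set R) :
  measurable_fun setT Z -> measurable B -> measurable (Z @^-1` B).
Proof. by move=> mZ mB; rewrite -[_ @^-1` _]setTI; exact: mZ. Qed.

Let measurable_indic_comp (D : set T) (Z : T -> R) (B : set R) :
  measurable_fun setT Z -> measurable B ->
  measurable_fun D (fun w => (\1_B (Z w) : R)).
Proof.
move=> mZ mB; apply: measurable_funTS.
exact: (measurableT_comp (@measurable_indic _ _ R setT B mB) mZ).
Qed.

Lemma integral_mul_nnsfun (D : set T) (G Z : T -> R) (h : {nnsfun R >-> R}) :
  measurable D -> measurable_fun setT G -> measurable_fun setT Z ->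
  (forall w, (0 <= G w)%R) ->
  \int[P]_(w in D) ((G w)%:E * (h (Z w))%:E) =
  \sum_(k \in range h) (k%:E * \int[P]_(w in D) ((G w)%:E * (\1_(h @^-1` [set k]) (Z w))%:E)).
Proof.
move=> mD mG mZ G0.
have mI k : measurable_fun D (fun w => ((\1_(h @^-1` [set k]) (Z w) : R)%:E)).
  by apply/measurable_EFinP; exact: measurable_indic_comp.
have mGI k : measurable_fun D (fun w => (G w)%:E * (\1_(h @^-1` [set k]) (Z w) : R)%:E).
  by apply: emeasurable_funM => //; apply/measurable_EFinP; exact: measurable_funTS.
have k0 k : range h k -> (0 <= k)%R by move=> [x _ <-].
transitivity (\int[P]_(w in D) \sum_(k \in range h)
    (k%:E * ((G w)%:E * (\1_(h @^-1` [set k]) (Z w))%:E))).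
  apply: eq_integral => w _; rewrite (fimfunE h (Z w)) -fsumEFin// ge0_mule_fsumr.
    by apply: eq_fsbigr => k _; rewrite EFinM muleCA.
  by move=> k; rewrite nnfun_muleindic_ge0.
rewrite ge0_integral_fsum//.
- apply: eq_fsbigr => k; rewrite inE => /k0 kp.
  by rewrite ge0_integralZl// => w _; rewrite mule_ge0// lee_fin.
- by move=> k; apply: emeasurable_funM.
- move=> k w _; rewrite muleCA mule_ge0//; first by rewrite lee_fin.
  by rewrite -EFinM nnfun_muleindic_ge0.
Qed.

(** Indicators give simple functions, and these give [f] by monotone convergence. The weights and
    domains allow one factor of a product to be replaced while the others are kept. *)
Lemma integral_mul_eq_law (D1 D2 : set T) (G1 G2 Z1 Z2 : T -> R) (f : R -> R) :
  measurable D1 -> measurable D2 ->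
  measurable_fun setT G1 -> measurable_fun setT G2 ->
  measurable_fun setT Z1 -> measurable_fun setT Z2 ->
  (forall w, (0 <= G1 w)%R) -> (forall w, (0 <= G2 w)%R) ->
  (forall B, measurable B ->
    \int[P]_(w in D1) ((G1 w)%:E * (\1_B (Z1 w))%:E) =
    \int[P]_(w in D2) ((G2 w)%:E * (\1_B (Z2 w))%:E)) ->
  measurable_fun setT f -> (forall y, (0 <= f y)%R) ->
  \int[P]_(w in D1) ((G1 w)%:E * (f (Z1 w))%:E) =
  \int[P]_(w in D2) ((G2 w)%:E * (f (Z2 w))%:E).
Proof.
move=> mD1 mD2 mG1 mG2 mZ1 mZ2 G10 G20 GE mf f0.
have mf' : measurable_fun setT (EFin \o f) by exact/measurable_EFinP.
pose f_ := nnsfun_approx measurableT mf'.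
have H (D : set T) (G Z : T -> R) : measurable D -> measurable_fun setT G -> measurable_fun setT Z ->
    (forall w, (0 <= G w)%R) ->
    \int[P]_(w in D) ((G w)%:E * (f (Z w))%:E) =
    limn (fun n => \int[P]_(w in D) ((G w)%:E * (f_ n (Z w))%:E)).
  move=> mD mG mZ G0; rewrite -monotone_convergence//.
  - apply: eq_integral => w _; apply/esym/cvg_lim => //.
    apply: cvgeZl => //.
    by apply: (@cvg_nnsfun_approx _ _ _ _ _ _ mf' _ (Z w)) => // y _; rewrite lee_fin.
  - move=> n; apply: emeasurable_funM; apply/measurable_EFinP/measurable_funTS => //.
    exact: measurableT_comp.
  - by move=> n w _; rewrite mule_ge0// lee_fin.
  - move=> w _ m n mn; rewrite lee_pmul ?lee_fin//; exact/lefP/nd_nnsfun_approx.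
rewrite !H//; congr (lim (_ @ \oo)); apply/funext => n.
rewrite !integral_mul_nnsfun//; apply: eq_fsbigr => k _.
by rewrite GE.
Qed.

Lemma integral_eq_law (Z1 Z2 : T -> R) (f : R -> R) :
  measurable_fun setT Z1 -> measurable_fun setT Z2 ->
  (forall B, measurable B -> P (Z1 @^-1` B) = P (Z2 @^-1` B)) ->
  measurable_fun setT f -> (forall y, (0 <= f y)%R) ->
  \int[P]_w (f (Z1 w))%:E = \int[P]_w (f (Z2 w))%:E.
Proof.
move=> mZ1 mZ2 PE mf f0.
have := @integral_mul_eq_law setT setT (cst 1%R) (cst 1%R) Z1 Z2 f.
have E (Z : T -> R) : \int[P]_w ((cst 1%R w)%:E * (f (Z w))%:E) = \int[P]_w (f (Z w))%:E.
  by apply: eq_integral => w _; rewrite mul1e.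
rewrite !E; apply => // B mB.
have EI (Z : T -> R) : measurable_fun setT Z ->
    \int[P]_w ((cst 1%R w)%:E * (\1_B (Z w))%:E) = P (Z @^-1` B).
  move=> mZ; under eq_integral do rewrite mul1e.
  rewrite -[in RHS](setIT (_ @^-1` _)) -integral_indic//; exact: measurable_preim.
by rewrite !EI// PE.
Qed.

Variables (n : nat) (X : 'I_n -> T -> R).
Hypothesis mX : forall i, measurable_fun setT (X i).

(* The factors are replaced one at a time, indicators first, the others through
   [integral_mul_eq_law]. *)
Lemma integral_prod_indep (D : set T) (u : R) (f : 'I_n -> R -> R) :
  measurable D -> (0 <= u)%R ->
  (forall B : 'I_n -> set R, (forall i, measurable (B i)) ->
     P (D `&` [set w | forall i, B i (X i w)]) = (\prod_(i < n) P (X i @^-1` B i)) * u%:E) ->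
  (forall i, measurable_fun setT (f i)) -> (forall i y, (0 <= f i y)%R) ->
  (forall i, \int[P]_w (f i (X i w))%:E < +oo) ->
  \int[P]_(w in D) (\prod_(i < n) f i (X i w))%:E =
  (\prod_(i < n) \int[P]_w (f i (X i w))%:E) * u%:E.
Proof.
move=> mD u0 hD.
have EI i (B : set R) : measurable B -> \int[P]_w (\1_B (X i w))%:E = P (X i @^-1` B).
  move=> mB; rewrite -[in RHS](setIT (_ @^-1` _)) -integral_indic//; exact: measurable_preim.
(* Induction on [j], all factors from index [j] on being indicators; the product rule for sets is
   the case [j = 0]. *)
suff H j : (j <= n)%N -> (forall i : 'I_n, (j <= i)%N -> exists2 B, measurable B & f i = \1_B) ->
    (forall i, measurable_fun setT (f i)) -> (forall i y, (0 <= f i y)%R) ->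
    (forall i, \int[P]_w (f i (X i w))%:E < +oo) ->
    \int[P]_(w in D) (\prod_(i < n) f i (X i w))%:E =
    (\prod_(i < n) \int[P]_w (f i (X i w))%:E) * u%:E.
  by apply: (H n) => // i; rewrite leqNgt ltn_ord.
elim: j f => [|j IH] f jn fB mf f0 foo.
  have /choice[B hB] : forall i, exists B, measurable B /\ f i = \1_B.
    by move=> i; have [B mB ->] := fB i isT; exists B.
  transitivity (P (D `&` [set w | forall i, B i (X i w)])).
    rewrite setIC -(integral_indic _ mD).
      apply: eq_integral => w _; congr EFin; rewrite indicE.
      case: (boolP (w \in _)) => [|]; rewrite ?notin_setE ?inE /= => h.
        by rewrite big1// => i _; rewrite (hB i).2 indicE mem_set.
      have /existsNP[i hi] := h; rewrite (bigD1 i)//= (hB i).2 indicE memNset//.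
      by rewrite mul0r.
    rewrite (_ : [set w | _] = \bigcap_(i in [set: 'I_n]) (X i @^-1` B i)); last first.
      by apply/seteqP; split => w /= h i => [_|]; exact: h.
    apply: fin_bigcap_measurable => // i _; apply: measurable_preim => //; exact: (hB i).1.
  rewrite hD; last by move=> i; exact: (hB i).1.
  by congr (_ * _); apply: eq_bigr => i _; rewrite (hB i).2 EI//; exact: (hB i).1.
pose i0 := Ordinal jn.
pose G w : R := (\prod_(i < n | i != i0) f i (X i w))%R.
pose C := \prod_(i < n | i != i0) \int[P]_w (f i (X i w))%:E.
have C0 : 0 <= C by apply: prode_ge0 => i _; apply: integral_ge0 => w _; rewrite lee_fin.
have Cfin : C \is a fin_num.
  apply: prode_fin_num => i _; rewrite ge0_fin_numE//.
  by apply: integral_ge0 => w _; rewrite lee_fin.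
pose c := (fine C * u)%R.
have cE : c%:E = C * u%:E by rewrite EFinM fineK.
have mG : measurable_fun setT G.
  rewrite /G; under eq_fun do rewrite big_mkcond.
  apply: measurable_prod => i _; case: (i != i0) => //.
  exact: measurableT_comp.
have G0 w : (0 <= G w)%R by apply: prodr_ge0.
(* Only the factor at [i0] is compared: its weight is the product [G] of the others over [D] on one
   side, and the constant [c] over the whole space on the other. *)
transitivity (\int[P]_w ((cst c w)%:E * (f i0 (X i0 w))%:E)); last first.
  rewrite /= ge0_integralZl//.
  - by rewrite cE (bigD1 i0)//= -/C muleC muleA.
  - by apply/measurable_EFinP; exact: measurableT_comp.
  - by move=> w _; rewrite lee_fin.
  - by rewrite lee_fin mulr_ge0// fine_ge0.
transitivity (\int[P]_(w in D) ((G w)%:E * (f i0 (X i0 w))%:E)).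
  by apply: eq_integral => w _; rewrite (bigD1 i0)//= mulrC EFinM.
apply: integral_mul_eq_law => //.
  by move=> w; rewrite /= mulr_ge0// fine_ge0.
move=> B mB; pose fb i := if i == i0 then \1_B else f i.
have := IH fb (ltnW jn).
have E1 : \int[P]_(w in D) (\prod_(i < n) fb i (X i w))%:E =
    \int[P]_(w in D) ((G w)%:E * (\1_B (X i0 w))%:E).
  apply: eq_integral => w _; rewrite (bigD1 i0)//= mulrC EFinM /fb eqxx.
  by congr (_%:E * _); apply: eq_bigr => i /negbTE ->.
rewrite E1 => ->.
- rewrite (bigD1 i0)//= {1}/fb eqxx EI//= ge0_integralZl//.
  + rewrite EI// cE [RHS]muleC muleA; congr (_ * _ * _).
    by apply: eq_bigr => i /negbTE h; rewrite /fb h.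
  + by apply/measurable_EFinP; exact: measurable_indic_comp.
  + by rewrite lee_fin mulr_ge0// fine_ge0.
- move=> i; rewrite leq_eqVlt => /predU1P[ji|ji]; rewrite /fb.
    by rewrite (_ : i == i0) ?ji; [exists B|apply/eqP/val_inj].
  by case: ifP => _; [exists B|exact: fB].
- by move=> i; rewrite /fb; case: ifP => // _; exact: measurable_indic.
- by move=> i y; rewrite /fb; case: ifP.
- move=> i; rewrite /fb; case: ifP => // _; rewrite EI//.
  by rewrite (le_lt_trans (probability_le1 _ _)) ?ltry//; exact: measurable_preim.
Qed.

End EqualLaws.

(** * Expectation of a truncated exponential under a moment condition *)

Section BlockTail.
Local Open Scope ereal_scope.
Context d (T : measurableType d) (R : realType) (P : probability T R).

(** The random set takes finitely many values, each on a finite intersection of the given events and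
    their complements. *)
Lemma measurable_finset_pred (I : finType) (b : I -> T -> bool) (Phi : set {set I}) :
  (forall i, measurable [set w | b i w]) ->
  measurable [set w | Phi [set i | b i w]%SET].
Proof.
move=> mb.
rewrite (_ : [set w | _] = \bigcup_(A in Phi)
    \bigcap_(i in [set: I]) (if i \in A then [set w | b i w] else ~` [set w | b i w])).
  apply: fin_bigcup_measurable => [|A _]; first exact: finite_finset.
  apply: fin_bigcap_measurable => [|i _]; first exact: finite_finset.
  by case: ifP => _; [exact: mb|exact: measurableC].
apply/seteqP; split => w /=.
  by move=> h; exists [set i | b i w]%SET => // i _; rewrite inE; case: ifP => // /negbT/negP.
move=> [A PA hA]; rewrite (_ : [set i | b i w]%SET = A)//.
apply/setP => i; rewrite inE; have := hA i Logic.I; case: ifP => _ //= /negP/negbTE //.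
Qed.

(** Put [z = |y| / b]. If [z <= 1], then [z^2 <= z^(1+a)] because [1 + a <= 2]; otherwise the left
    side is [3 < 2 + 9/5] and [z^(1+a) >= 1]. *)
Lemma trunc_expD_le_powR (a b y : R) : (0 < a <= 1)%R -> (0 < b)%R ->
  (trunc_exp true b y + trunc_exp false b y
    <= 2 + 9 / 5 / b `^ (1 + a) * `|y| `^ (1 + a))%R.
Proof.
move=> /andP[a0 a1] bp; have z0 : (0 <= `|y| / b)%R by rewrite divr_ge0// ltW.
have bp1 : (0 < b `^ (1 + a))%R by rewrite powR_gt0.
have E : (9 / 5 / b `^ (1 + a) * `|y| `^ (1 + a) = 9 / 5 * (`|y| / b) `^ (1 + a))%R.
  rewrite -[in LHS](divfK (lt0r_neq0 bp) (`|y|)%R) powRM//; last exact: ltW.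
  by field; rewrite lt0r_neq0.
rewrite E; have [Yb|bY] := leP (`|y|)%R b.
  apply: le_trans (trunc_expD_le (ltW bp) Yb) _; rewrite lerD2l ler_wpM2l//.
  rewrite -(real_normK (num_real _)) normrM normfV (gtr0_norm bp).
  have [->|zN0] := eqVneq (`|y| / b)%R 0%R; first by rewrite expr0n/= powR_ge0.
  rewrite -powR_mulrn// ger_powR//; last lra.
  by rewrite lt_neqAle eq_sym zN0 z0 ler_pdivrMr// mul1r.
rewrite /trunc_exp (lt_geF bY) /=.
have : (1 <= (`|y| / b) `^ (1 + a))%R.
  have := @ge0_ler_powR R (1 + a)%R _ 1%R (`|y| / b)%R; rewrite powR1; apply.
  - by lra.
  - by rewrite nnegrE.
  - by rewrite nnegrE.
  - by rewrite ler_pdivlMr// mul1r ltW.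
lra.
Qed.

(** By symmetry both values of [tau] give the same expectation, hence half that of the sum. For
    [b > 0] this is at most [1 + (9/10) M / b^(1+a)], and the condition on [b] makes it at most
    [1 + 9 / (120 N)]. *)
Lemma integral_trunc_exp_le (Y : T -> R) (a M b : R) (N : nat) tau :
  measurable_fun setT Y ->
  (forall B, measurable B -> P (Y @^-1` B) = P ((fun w => - Y w)%R @^-1` B)) ->
  (0 < a <= 1)%R -> \int[P]_w (`|Y w| `^ (1 + a))%:E = M%:E ->
  (0 <= b)%R -> (0 < N)%N -> (12 * M * N%:R <= b `^ (1 + a))%R ->
  \int[P]_w (trunc_exp tau b (Y w))%:E <= (1 + 3 / (40 * N%:R))%:E.
Proof.
move=> mY sY /andP[a0 a1] hM b0 N0 hb.
have NR0 : (0 < N%:R :> R)%R by rewrite ltr0n.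
have mf t : measurable_fun setT (fun w => (trunc_exp t b (Y w))%:E).
  by apply/measurable_EFinP; apply: measurableT_comp => //; exact: measurable_trunc_exp.
have f0 t w : 0 <= (trunc_exp t b (Y w))%:E by rewrite lee_fin ltW// trunc_exp_gt0.
have flip : \int[P]_w (trunc_exp false b (Y w))%:E = \int[P]_w (trunc_exp true b (Y w))%:E.
  rewrite (@integral_eq_law _ _ _ P Y (fun w => - Y w)%R (trunc_exp false b))//.
  - by apply: eq_integral => w _; rewrite -mulN1r -[(-1)%R]/(sgb R false) trunc_exp_sgb.
  - exact: measurableT_comp.
  - exact: measurable_trunc_exp.
  - by move=> y; rewrite ltW// trunc_exp_gt0.
move: sY => _; have tauE : \int[P]_w (trunc_exp tau b (Y w))%:E = \int[P]_w (trunc_exp true b (Y w))%:E.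
  by case: tau.
rewrite tauE.
have mp : measurable_fun setT (fun w => (`|Y w| `^ (1 + a))%:E).
  apply/measurable_EFinP; apply: (measurableT_comp (measurable_powR _)) => //.
  exact: measurableT_comp.
have p0 w : 0 <= (`|Y w| `^ (1 + a))%:E by rewrite lee_fin powR_ge0.
have M0 : (0 <= M)%R by rewrite -lee_fin -hM; apply: integral_ge0.
suff H : \int[P]_w ((trunc_exp true b (Y w))%:E + (trunc_exp false b (Y w))%:E)
    <= (2 + 9 / 5 / (12 * N%:R))%:E.
  move: H; rewrite ge0_integralD// flip.
  case: (\int[P]_w _) => [r|//|_]; last by rewrite leNye.
  by rewrite -EFinD !lee_fin (_ : 9 / 5 / (12 * N%:R) = 2 * (3 / (40 * N%:R)) :> R)%R; [lra|field; lra].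
(* If [b = 0], the condition on [b] forces [M = 0], so [Y] vanishes almost everywhere and both
   truncated exponentials are [1] there. *)
have [b00|bN0] := eqVneq b 0%R.
  have M00 : M = 0%R.
    move: hb; rewrite b00 powR0 => [|]; [nra|by apply: lt0r_neq0; lra].
  have Y0 : ae_eq P setT (fun w => (`|Y w| `^ (1 + a))%:E) (cst 0).
    apply/ae_eq_integral_abs => //.
    by under eq_integral do rewrite gee0_abs//; rewrite hM M00.
  rewrite (@ae_eq_integral _ _ _ P setT (cst 2%:E))//.
  - rewrite integral_cst//= probability_setT mule1 lee_fin lerDl divr_ge0//.
  - by apply: emeasurable_funD; exact: mf.
  - apply: filterS Y0 => w /(_ Logic.I) [] /powR_eq0_eq0 /eqP.
    rewrite normr_eq0 => /eqP Y0 _.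
    by rewrite /trunc_exp Y0 normr0 b00 lexx mul0r !mulr0 expR0 -EFinD.
have bp : (0 < b)%R by rewrite lt_neqAle eq_sym bN0.
have bp1 : (0 < b `^ (1 + a))%R by rewrite powR_gt0.
apply: (@le_trans _ _ (\int[P]_w (2%:E + (9 / 5 / b `^ (1 + a))%:E * (`|Y w| `^ (1 + a))%:E))).
  apply: ge0_le_integral => //.
  - by move=> w _; rewrite adde_ge0.
  - exact: emeasurable_funD.
  - by apply: emeasurable_funD => //; exact: emeasurable_funM.
  - move=> w _; rewrite -EFinD -EFinM -EFinD lee_fin.
    by apply: trunc_expD_le_powR => //; rewrite a0.
rewrite ge0_integralD//; last 2 first.
- by move=> w _; rewrite mule_ge0// lee_fin divr_ge0 ?ltW//; lra.
- exact: emeasurable_funM.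
rewrite integral_cst//= probability_setT mule1 ge0_integralZl//; last first.
  by rewrite lee_fin divr_ge0 ?ltW//; lra.
rewrite hM -EFinM -EFinD lee_fin lerD2l.
rewrite -[leLHS]mulrA ler_wpM2l//.
rewrite mulrC ler_pdivrMr// [leRHS]mulrC ler_pdivlMr ?mulr_gt0//.
by apply: le_trans hb; rewrite mulrCA mulrA.
Qed.

End BlockTail.

(** * Tail bound for the number of large block means *)

Section BlockTail.
Context d (T : measurableType d) (R : realType) (P : probability T R).
Variables (n k : nat) (kn : (0 < k <= n)%N).
Variables (X : 'I_n -> T -> R) (mX : forall i, measurable_fun setT (X i)).

Lemma measurable_ltr_set (f g : T -> R) :
  measurable_fun setT f -> measurable_fun setT g -> measurable [set w | f w < g w].
Proof.
move=> mf mg; have := measurable_fun_ltr mf mg measurableT (Y := [set true]) Logic.I.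
by rewrite setTI.
Qed.

Let k0 : (0 < k)%N := k_gt0 kn.

Definition block_of (i : 'I_n) : 'I_k := Ordinal (ltn_pmod i k0).

Lemma in_block i l : (i \in block n l) = (block_of i == l).
Proof. by rewrite inE. Qed.

Lemma prod_blocks (F : 'I_n -> R) :
  \prod_(l < k) \prod_(i in block n l) F i = \prod_(i < n) F i.
Proof.
rewrite (partition_big block_of xpredT)//=; apply: eq_bigr => l _.
by apply: eq_bigl => i; rewrite in_block.
Qed.

Lemma measurable_block_count (c : 'I_n -> bool) (mu s : R) :
  measurable [set w | (k <= 2 * #|[set l : 'I_k | (#|block n l|%:R * s <
     \sum_(i in block n l) sgb R (c i) * (X i w - mu))%R]%SET|)%N].
Proof.
apply: (@measurable_finset_pred _ _ _ _ [set A : {set 'I_k} | (k <= 2 * #|A|)%N]) => l.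
apply: measurable_ltr_set => //.
under eq_fun do rewrite big_mkcond; apply: measurable_sum => i.
case: (i \in block n l) => //; apply: measurable_funM => //; exact: measurable_funB.
Qed.

(** Intersection with [D] stands for conditioning: [u] is the probability of [D], and for [u > 0]
    the product rule says that given [D] the [X i] are independent with their own laws. *)
Lemma block_count_tail (D : set T) (u mu s : R) (c : 'I_n -> bool) :
  measurable D -> 0 <= u -> 0 <= s ->
  (forall B : 'I_n -> set R, (forall i, measurable (B i)) ->
     P (D `&` [set w | forall i, B i (X i w)]) =
       (\prod_(i < n) P (X i @^-1` B i) * u%:E)%E) ->
  (forall i tau (N := #|block n (block_of i)|),
     (\int[P]_w (trunc_exp tau (N%:R * s) (X i w - mu))%:E <= (1 + 3 / (40 * N%:R))%:E)%E) ->
  (P (D `&` [set w | (k <= 2 * #|[set l : 'I_k | (#|block n l|%:R * s <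
     \sum_(i in block n l) sgb R (c i) * (X i w - mu))%R]%SET|)%N])
   <= (u * expR (- k%:R / 8))%:E)%E.
Proof.
move=> mD u0 s0 hD hE.
pose N (l : 'I_k) : R := #|block n l|%:R.
have N0 l : 0 < N l by exact: (block_card_gt0 R kn).
set E := [set w | _].
have mE : measurable E by exact: measurable_block_count.
pose f (tau : {ffun 'I_k -> bool}) i y :=
  trunc_exp (tau (block_of i)) (N (block_of i) * s) (sgb R (c i) * (y - mu)).
have mf tau i : measurable_fun setT (f tau i).
  apply: measurableT_comp; first exact: measurable_trunc_exp.
  by apply: measurable_funM => //; exact: measurable_funB.
have f0 tau i y : 0 <= f tau i y by rewrite ltW// trunc_exp_gt0.
have hf tau i : (\int[P]_w (f tau i (X i w))%:E <= (1 + 3 / (40 * N (block_of i)))%:E)%E.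
  by under eq_integral do rewrite /f trunc_exp_sgb; exact: hE.
(* With [r^2 = exp (2/5)], at least [k / 2] heavy blocks contribute at least [r^k], whatever the
   parity of [k]. *)
have [r [rr r1 rE]] : exists r : R, [/\ r ^+ 2 = expR (2/5), 1 <= r & r = expR (1/5)].
  exists (expR (1/5)); split=> //; last by rewrite -[leLHS]expR0 ler_expR; lra.
  by rewrite -expRM_natr; congr expR; field.
have rk0 : 0 < r ^+ k by rewrite exprn_gt0//; lra.
(* [2^-k] averages over [tau], and [r^-k] is the factor of Markov's inequality. *)
pose K := (r ^+ k * 2 ^+ k)^-1 : R.
have K0 : 0 <= K by rewrite invr_ge0 mulr_ge0// ltW.
have H w : (\1_E w : R) <= \sum_(tau : {ffun 'I_k -> bool}) K * \prod_(i < n) f tau i (X i w).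
  rewrite -mulr_sumr.
  pose y i := sgb R (c i) * (X i w - mu).
  pose h l := (\prod_(i in block n l) trunc_exp true (N l * s) (y i)
               + \prod_(i in block n l) trunc_exp false (N l * s) (y i)) / 2.
  have hsum : \sum_(tau : {ffun 'I_k -> bool}) \prod_(i < n) f tau i (X i w)
      = 2 ^+ k * \prod_(l < k) h l.
    rewrite /h big_split/= prodr_const card_ord exprVn mulrCA mulfV ?expf_neq0 ?pnatr_eq0// mulr1.
    under [RHS]eq_bigr => l _ do rewrite -(big_bool _ (fun b => \prod_(i in block n l) trunc_exp b (N l * s) (y i))).
    rewrite bigA_distr_bigA/=; apply: eq_bigr => tau _.
    rewrite -(prod_blocks (fun i => f tau i (X i w))); apply: eq_bigr => l _.
    by apply: eq_bigr => i; rewrite in_block /f => /eqP ->.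
  rewrite hsum /K invfM mulrA mulfVK ?expf_neq0 ?pnatr_eq0//.
  rewrite mulrC ler_pdivlMr//.
  have h1 l : 1 <= h l by exact: prod_trunc_expD_ge.
  rewrite indicE; case: (boolP (w \in E)) => [|_]; last first.
    by rewrite mul0r prodr_ge0// => l _; rewrite (le_trans ler01).
  rewrite inE /E/= mul1r; set A := finset _ => hA.
  apply: (@le_trans _ _ (expR (2/5) ^+ #|A|)).
    by rewrite -rr -exprM ler_weXn2l.
  rewrite (bigID (mem A))/= -[leLHS]mulr1 ler_pM//.
  - rewrite -prodr_const; apply: ler_prod => l lA; rewrite expR_ge0/=.
    apply: le_trans (expR_2_5_le R) _; apply: prod_trunc_expD_gt; last by move: lA; rewrite inE.
    by rewrite mulr_ge0// ltW.
  - by elim/big_ind: _ => // z1 z2 hz1 hz2; exact: mulr_ege1.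
have -> : P (D `&` E) = (\int[P]_(w in D) (\1_E w)%:E)%E.
  by rewrite integral_indic// setIC.
have mprod tau : measurable_fun D (fun w => (\prod_(i < n) f tau i (X i w))%:E).
  apply/measurable_EFinP/measurable_funTS; apply: measurable_prod => i _.
  exact: measurableT_comp.
have p0 tau w : 0 <= \prod_(i < n) f tau i (X i w) by rewrite prodr_ge0.
apply: (@le_trans _ _ (\int[P]_(w in D) \sum_(tau : {ffun 'I_k -> bool})
    (K%:E * (\prod_(i < n) f tau i (X i w))%:E))%E).
  apply: ge0_le_integral => //.
  - by apply/measurable_EFinP; exact: measurable_indic.
  - by apply: emeasurable_sum => tau; exact: emeasurable_funM.
  - by move=> w _; rewrite sumEFin lee_fin.
rewrite ge0_integral_sum//; last 2 first.
- by move=> tau; exact: emeasurable_funM.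
- by move=> tau w _; rewrite mule_ge0// lee_fin.
apply: (@le_trans _ _ (\sum_(tau : {ffun 'I_k -> bool})
    (K * (\prod_(i < n) (1 + 3 / (40 * N (block_of i))) * u))%:E)%E).
  apply: lee_sum => tau _; rewrite ge0_integralZl//; last by move=> w _; rewrite lee_fin.
  rewrite (integral_prod_indep mX mD u0 hD)//; last first.
    by move=> i; rewrite (le_lt_trans (hf _ _))// ltry.
  rewrite !EFinM lee_wpmul2l ?lee_fin// lee_wpmul2r ?lee_fin//.
  (* Nonnegativity is carried along, since multiplying upper bounds requires it. *)
  rewrite -prodEFin; apply: (proj2 (A := (0 <= \prod_(i < n) \int[P]_w (f tau i (X i w))%:E)%E) _).
  elim/big_ind2: _ => [|x1 x2 y1 y2 [? ?] [? ?]|i _]; first by [].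
    by split; [exact: mule_ge0|exact: lee_pmul].
  by split=> //; apply: integral_ge0 => w _; rewrite lee_fin.
rewrite sumEFin lee_fin sumr_const cardT -cardE card_ffun card_bool card_ord.
rewrite -[leLHS]mulr_natr natrX [K * _]mulrC -mulrA.
rewrite /K invfM mulfVK ?expf_neq0 ?pnatr_eq0// mulrAC mulrC ler_wpM2l//.
rewrite ler_pdivrMr//.
rewrite -(prod_blocks (fun i => 1 + 3 / (40 * N (block_of i)))).
(* A block has [N l] equal factors, whose product is at most [exp (3/40)] whatever its size. *)
apply: (@le_trans _ _ (\prod_(l < k) expR (3/40))).
  apply: ler_prod => l _; apply/andP; split.
    by apply: prodr_ge0 => i _; rewrite addr_ge0// divr_ge0// mulr_ge0// ltW.
  rewrite (eq_bigr (fun=> 1 + 3 / (40 * N l))); last by move=> i; rewrite in_block => /eqP ->.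
  rewrite prodr_const.
  apply: le_trans (expR_natM_ge _ _) _; last first.
    rewrite ler_expR -/(N l) (_ : N l * _ = 3/40)//; field; exact: lt0r_neq0 (N0 l).
  have : 0 <= 3 / (40 * N l) by rewrite divr_ge0// mulr_ge0.
  by apply: le_trans; rewrite lerN10.
rewrite prodr_const card_ord rE -!expRM_natr -expRD ler_expR; lra.
Qed.

End BlockTail.

(** * Sums of signs *)

Section SignSums.
Variables (R : realType) (K : finType).
Implicit Types (B : {set K}) (v : {ffun K -> bool}).

(* The weights are [w] and [w^-3] with [w = 4/3]: their product over [B] is at
   least [1] as soon as the signs in [B] sum to more than [#|B| / 2], and their
   average [337/384] is below [exp (-1/8)]. *)
Definition sign_weight (b : bool) : R := if b then 4/3 else 27/64.

Lemma sign_weight_ge0 b : 0 <= sign_weight b.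
Proof. by case: b => /=; lra. Qed.

(** With [p] plus and [q] minus signs the hypothesis gives [p >= 3 q], and each minus sign is
    compensated by three plus signs: [(4/3)^3 * 27/64 = 1]. *)
Lemma prod_sign_weight_ge1 B v : #|B|%:R / 2 < \sum_(i in B) sgb R (v i) ->
  1 <= \prod_(i in B) sign_weight (v i).
Proof.
move=> h.
have [p [q [Ep Eq Es]]] : exists p q : nat, [/\ #|B| = (p + q)%N,
    \prod_(i in B) sign_weight (v i) = (4/3) ^+ p * (27/64) ^+ q &
    \sum_(i in B) sgb R (v i) = p%:R - q%:R].
  exists #|[set i in B | v i]|, #|[set i in B | ~~ v i]|; split.
  - by rewrite -!sum1_card (bigID v)/=; congr addn; apply: eq_bigl => i; rewrite inE.
  - rewrite (bigID v)/= -!prodr_const; congr (_ * _); apply: eq_big => i; rewrite ?inE//.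
      by move=> /andP[_ ->].
    by move=> /andP[_ /negbTE ->].
  - rewrite (bigID v)/= -!sumr_const -sumrN; congr (_ + _); apply: eq_big => i; rewrite ?inE//.
      by move=> /andP[_ ->].
    by move=> /andP[_ /negbTE ->].
have qp : (3 * q <= p)%N by rewrite -(ler_nat R) natrM; move: h; rewrite Es Ep natrD; lra.
rewrite Eq -(subnK qp) exprD exprM -mulrA -exprMn (_ : (4/3) ^+ 3 * (27/64) = 1); last by field.
by rewrite expr1n mulr1 exprn_ege1//; lra.
Qed.

(** The sum factors over coordinates: [4/3 + 27/64 = 2 * 337/384] inside [B], and [2] outside. The
    injection [f] covers both the signs and their negations. *)
Lemma sum_prod_sign_weight B (f : bool -> bool) : injective f ->
  \sum_(v : {ffun K -> bool}) \prod_(i in B) sign_weight (f (v i)) =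
  2 ^+ #|K| * (337/384) ^+ #|B|.
Proof.
move=> fi; under eq_bigr do rewrite big_mkcond/=.
rewrite -(bigA_distr_bigA (fun i b => if i \in B then sign_weight (f b) else 1))/=.
rewrite (eq_bigr (fun i => 2 * (if i \in B then 337/384 else 1))) => [|i _].
  by rewrite big_split/= prodr_const -big_mkcond/= prodr_const.
rewrite big_bool/=; case: ifP => _; last by field.
have : f true != f false by apply/eqP => /fi.
by case: (f true) (f false) => -[]//= _; field.
Qed.

(** Markov's inequality in counting form, applied to the sign vector and to its negation for the two
    tails. *)
Lemma card_sign_sum_gt B :
  (#|[set v : {ffun K -> bool} | (#|B|%:R / 2 < `|\sum_(i in B) sgb R (v i)|)%R]%SET|%:R : R)
  <= 2 ^+ #|K| * (2 * expR (- #|B|%:R / 8)).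
Proof.
rewrite -sum1_card natr_sum.
apply: (@le_trans _ _ (\sum_(v : {ffun K -> bool})
   (\prod_(i in B) sign_weight (v i) + \prod_(i in B) sign_weight (~~ v i)))).
  rewrite big_mkcond/=; apply: ler_sum => v _.
  have p0 : 0 <= \prod_(i in B) sign_weight (v i) by rewrite prodr_ge0// => i _; exact: sign_weight_ge0.
  have q0 : 0 <= \prod_(i in B) sign_weight (~~ v i) by rewrite prodr_ge0// => i _; exact: sign_weight_ge0.
  rewrite inE ltr_normr; case: ifP => [/orP[/prod_sign_weight_ge1|h]|_]; rewrite ?addr_ge0//; first lra.
  suff : 1 <= \prod_(i in B) sign_weight (~~ v i) by lra.
  have := @prod_sign_weight_ge1 B [ffun i => ~~ v i].
  rewrite (eq_bigr (fun i => sgb R (~~ v i))) => [|i _]; last by rewrite ffunE.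
  rewrite [\prod_(i in B) _](eq_bigr (fun i => sign_weight (~~ v i))) => [|i _]; last by rewrite ffunE.
  apply; apply: lt_le_trans h _; rewrite -sumrN; apply: ler_sum => i _.
  by case: (v i); rewrite /sgb /= ?opprK.
rewrite big_split/= (sum_prod_sign_weight B (@inj_id bool)) (sum_prod_sign_weight B (can_inj negbK)).
rewrite -mulrDr ler_wpM2l ?exprn_ge0// -mulr2n -[leLHS]mulr_natl ler_wpM2l//.
rewrite (_ : - #|B|%:R / 8 = - (1/8) * #|B|%:R); last lra.
by rewrite expRM_natr; apply: lerXn2r (expR_N1_8_ge R); rewrite nnegrE ?expR_ge0//; lra.
Qed.

End SignSums.

(** * Measurability *)

Section MeasurableExists.
Import numFieldNormedType.Exports.
Context d (T : measurableType d) (R : realType).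

Lemma exists_uniform_gap (I : eqType) (s : seq I) (h : I -> R) :
  exists2 g : R, 0 < g & {in s, forall i, 0 < h i -> g <= h i}.
Proof.
elim: s => [|i s [g g0 gs]]; first by exists 1.
have [hi|hi] := ltP 0 (h i).
  exists (Num.min g (h i)); first by rewrite lt_min g0.
  move=> j; rewrite inE => /predU1P[->|js] hj; rewrite ge_min ?lexx ?orbT//.
  by rewrite gs.
exists g => // j; rewrite inE => /predU1P[->|js]; last exact: gs.
by rewrite ltNge hi.
Qed.

Lemma measurable_prop (Q : Prop) : measurable [set _ : T | Q].
Proof.
have [q|nq] := pselect Q.
  by rewrite (_ : [set _ | Q] = setT)//; apply/seteqP; split.
by rewrite (_ : [set _ | Q] = set0)//; apply/seteqP; split.
Qed.

(** The sum [F] of twice the positive parts is continuous and attains its minimum on the compact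
    interval; approximate solutions bring this minimum below every [e > 0]. *)
Lemma lipschitz_argmin_nonpos (I : finType) (J : {set I}) (D : I -> R -> R) (K lo hi : R) :
  0 < K -> lo <= hi ->
  (forall i t t', D i t <= D i t' + K * `|t - t'|) ->
  (forall e, 0 < e -> exists2 t, lo <= t <= hi & forall i, i \in J -> D i t <= e) ->
  exists2 t, lo <= t <= hi & forall i, i \in J -> D i t <= 0.
Proof.
move=> K0 lohi lipD approx.
pose F (t : R) : R := \sum_(i in J) (`|D i t| + D i t).
have F0 i t : 0 <= `|D i t| + D i t by have := ler_norm (- D i t); rewrite normrN; lra.
have cD i : continuous (D i).
  move=> t; apply/cvgrPdist_le => e e0; near=> t'.
  have h1 := lipD i t t'; have h2 := lipD i t' t; rewrite distrC in h2.
  have : K * `|t - t'| <= e.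
    rewrite mulrC -ler_pdivlMr//; near: t'.
    by apply: (cvgr_dist_le (fun x : R => x) t) => //; rewrite divr_gt0.
  by rewrite ler_norml => ?; apply/andP; split; lra.
have cF : continuous F.
  rewrite (_ : F = fun t => \sum_(i <- enum J) (`|D i t| + D i t)); last first.
    by apply/funext => t; rewrite big_enum.
  elim: (enum J) => [|i s IH].
    rewrite (_ : (fun t : R => _) = cst 0); first exact: cst_continuous.
    by apply/funext => t; rewrite big_nil.
  rewrite (_ : (fun t : R => _) =
    (fun t => `|D i t| + D i t + \sum_(i <- s) (`|D i t| + D i t))); last first.
    by apply/funext => t; rewrite big_cons.
  move=> t; apply: cvgD; last exact: IH.
  by apply: cvgD; [apply: cvg_norm|]; exact: cD.
have [t0 t0I t0min] := @EVT_min R F lo hi lohi (continuous_subspaceT cF).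
exists t0; first by move: t0I; rewrite in_itv.
suff F00 : F t0 <= 0.
  move=> i iJ; have : `|D i t0| + D i t0 <= 0.
    apply: le_trans F00; rewrite /F (bigD1 i)//= lerDl.
    by apply: sumr_ge0 => j _; exact: F0.
  have := normr_ge0 (D i t0); lra.
apply/ler_addgt0Pl => e e0; rewrite addr0.
have e'0 : 0 < e / (2 * #|J|.+1%:R) by rewrite divr_gt0// mulr_gt0.
have [t tI tJ] := approx _ e'0.
apply: le_trans (t0min t _) _; first by rewrite in_itv.
rewrite /F; apply: (@le_trans _ _ (\sum_(i in J) (e / #|J|.+1%:R))).
  apply: ler_sum => i /tJ; move: e'0; set q := e / (2 * _) => q0 Dq.
  have -> : e / #|J|.+1%:R = 2 * q by rewrite /q; field.
  by have [D0|D0] := leP 0 (D i t); [rewrite ger0_norm//; lra|rewrite ltr0_norm//; lra].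
rewrite sumr_const -[leLHS]mulr_natr mulrAC ler_pdivrMr// ler_wpM2l ?ler_nat//.
exact: ltW.
Unshelve. all: by end_near. Qed.

(* The strict inequalities, if they hold at [t], hold with a uniform margin on a
   rational interval around [t]; on this compact interval the non-strict ones have
   a common solution iff rational points satisfy them up to any [1 / N.+1]. *)
Lemma measurable_exists_lipschitz (I : finType) (J : {set I}) (strict : pred I)
    (D : I -> T -> R -> R) (K c : R) : 0 < K ->
  (forall i t, measurable_fun setT (fun w => D i w t)) ->
  (forall i w t t', D i w t <= D i w t' + K * `|t - t'|) ->
  measurable [set w | exists t, c < t /\
     forall i, i \in J -> if strict i then D i w t < 0 else D i w t <= 0].
Proof.
move=> K0 mD lipD.
(* At [p] the strict inequalities have margin [K q], so they hold on all of [[p - q, p + q]], an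
   interval above [c]. *)
pose A (p q : rat) : set T := [set w | 0 < ratr q :> R /\ c < ratr p - ratr q :> R] `&`
  \bigcap_(i in [set i | (i \in J) && strict i]) [set w | D i w (ratr p) < - (K * ratr q)].
pose B (p q : rat) : set T := \bigcap_(N in [set: nat]) \bigcup_(r in [set: rat])
  ([set w | `|ratr r - ratr p| <= ratr q :> R] `&`
   \bigcap_(i in [set i | i \in J]) [set w | D i w (ratr r) < N.+1%:R^-1]).
rewrite (_ : [set w | _] = \bigcup_p \bigcup_q (A p q `&` B p q)).
  apply: bigcupT_measurable_rat => p; apply: bigcupT_measurable_rat => q.
  apply: measurableI.
    apply: measurableI; first exact: measurable_prop.
    apply: fin_bigcap_measurable => [|i _]; first exact: finite_finset.
    exact: measurable_ltr_set.
  apply: bigcap_measurable => [|N _]; first by exists 0%N.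
  apply: bigcupT_measurable_rat => r; apply: measurableI; first exact: measurable_prop.
  apply: fin_bigcap_measurable => [|i _]; first exact: finite_finset.
  exact: measurable_ltr_set.
apply/seteqP; split => w /=.
  move=> [t [ct tJ]].
  have [g g0 gJ] := exists_uniform_gap (enum I) (fun i => - D i w t).
  (* [4 K e <= g] pays for the move from [t] to [p] and for the margin [K q]; [2 e < t - c] keeps
     [p - q] above [c]. *)
  have [e [e0 eg ec]] : exists e : R, [/\ 0 < e, 4 * (K * e) <= g & 2 * e < t - c].
    exists (Num.min (g / (4 * K)) ((t - c) / 4)); split.
    - by rewrite lt_min !divr_gt0 ?mulr_gt0 ?subr_gt0.
    - have : Num.min (g / (4 * K)) ((t - c) / 4) <= g / (4 * K) by rewrite ge_min lexx.
      by rewrite ler_pdivlMr ?mulr_gt0//; lra.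
    - have : Num.min (g / (4 * K)) ((t - c) / 4) <= (t - c) / 4 by rewrite ge_min lexx orbT.
      lra.
  have [q] := rat_in_itvoo e0; rewrite in_itv/= => /andP[q0 qe].
  have [p] : exists p : rat, ratr p \in `](t - ratr q), (t + ratr q)[.
    by apply: rat_in_itvoo; lra.
  rewrite in_itv/= => /andP[pl pu].
  have Kq : K * ratr q <= K * e by rewrite ler_wpM2l// ltW.
  have Kq0 : 0 < K * ratr q by rewrite mulr_gt0.
  exists p => //; exists q => //; split.
    split; first by split=> //; lra.
    move=> i /= /andP[iJ si]; have := tJ i iJ; rewrite si => Dt0.
    have := gJ i; rewrite mem_enum oppr_gt0 => /(_ isT Dt0) => gD.
    have := lipD i w (ratr p) t.
    have : K * `|ratr p - t| <= K * ratr q.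
      by rewrite ler_wpM2l ?(ltW K0)// ler_norml; apply/andP; split; lra.
    lra.
  move=> N _.
  have : 0 < N.+1%:R^-1 :> R by rewrite invr_gt0.
  move: (N.+1%:R^-1) => v v0.
  pose e' := Num.min (ratr q - `|t - ratr p|) (v / (2 * K)).
  have tp : `|t - ratr p| < ratr q by rewrite ltr_norml; apply/andP; split; lra.
  have e'0 : 0 < e' by rewrite lt_min subr_gt0 tp divr_gt0// mulr_gt0.
  have e'1 : e' <= ratr q - `|t - ratr p| by rewrite ge_min lexx.
  have e'2 : K * e' < v.
    have : e' <= v / (2 * K) by rewrite ge_min lexx orbT.
    by rewrite ler_pdivlMr ?mulr_gt0//; lra.
  clearbody e'; have [r] : exists r : rat, ratr r \in `](t - e'), (t + e')[.
    by apply: rat_in_itvoo; lra.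
  rewrite in_itv/= => /andP[rl ru].
  have rt : `|ratr r - t| <= e' by rewrite ler_norml; apply/andP; split; lra.
  exists r => //; split => /=.
    by have := ler_distD t (ratr r) (ratr p); lra.
  move=> i iJ /=; have := lipD i w (ratr r) t.
  have : K * `|ratr r - t| <= K * e' by rewrite ler_wpM2l// ltW.
  have : D i w t <= 0 by have := tJ i iJ; case: ifP => // _ /ltW.
  lra.
move=> [p _ [q _ [[[q0 cpq] hA] hB]]].
have [|||t /andP[tl tu] tJ] := @lipschitz_argmin_nonpos I J (fun i => D i w) K
    (ratr p - ratr q) (ratr p + ratr q) K0.
- by lra.
- by move=> i; exact: lipD.
- move=> e e0; have [N Ne] : exists N : nat, N.+1%:R^-1 <= e.
    exists (Num.truncn e^-1); rewrite invf_ple ?posrE//.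
    by rewrite ltW// truncnS_gt.
  have [r _ [/= rp rJ]] := hB N Logic.I; exists (ratr r).
    by move: rp; rewrite ler_norml => /andP[? ?]; apply/andP; split; lra.
  by move=> i iJ; rewrite (le_trans _ Ne)// ltW// rJ.
exists t; split; first lra.
move=> i iJ; case: ifP => si; last exact: tJ.
have := lipD i w t (ratr p); have := hA i; rewrite /= iJ si => /(_ isT).
have : K * `|t - ratr p| <= K * ratr q.
  by rewrite ler_wpM2l ?(ltW K0)// ler_norml; apply/andP; split; lra.
lra.
Qed.

End MeasurableExists.

(** * Measurability of the rank event *)

Section RankEvent.
Context d (T : measurableType d) (R : realType).

Lemma measurable_median k (z : 'I_k -> T -> R) : (0 < k)%N ->
  (forall l, measurable_fun setT (z l)) ->
  measurable_fun setT (fun w => median [seq z l w | l <- enum 'I_k]).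
Proof.
move=> k0 mz; apply: (measurability _ (RGenOInfty.measurableE R)) => //.
move=> _ [_ [a ->] <-]; rewrite setTI preimage_itvoy.
rewrite (_ : [set w | _] = [set w | [set A : {set 'I_k} | ~~ (median_index k < #|A|)%N]
    [set l | (z l w <= a)%R]%SET]); last first.
  by apply/seteqP; split=> w /=; rewrite ltNge median_le.
apply: measurable_finset_pred => l.
rewrite -[[set w | _]]setTI; exact: measurable_fun_le.
Qed.

Variables (n k : nat) (kn : (0 < k <= n)%N).
Variables (X : 'I_n -> T -> R) (mX : forall i, measurable_fun setT (X i)).

Lemma measurable_Sstat (al : 'I_n -> nat -> bool) theta j :
  measurable_fun setT (fun w => Sstat k (fun i => X i w) al theta j).
Proof.
under eq_fun do rewrite Sstat_median//.
apply: measurable_median; first exact: k_gt0 kn.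
move=> l; apply: measurable_funM => //.
under eq_fun do rewrite big_mkcond; apply: measurable_sum => i.
case: (i \in block n l) => //; apply: measurable_funM => //; exact: measurable_funB.
Qed.

(** For each of the finitely many sets [A] of copies not above the original, the event is the
    solvability of a system of Lipschitz inequalities; the constant is [2] for a difference of two
    functions of constant [1]. *)
Lemma measurable_exists_rank_le (al : 'I_n -> nat -> bool) m (p : {perm 'I_m.+1}) (c : R) J :
  measurable [set w | exists t, c < t /\ (rankR k (fun i => X i w) al p t <= J)%N].
Proof.
pose S j w t := Sstat k (fun i => X i w) al t j.
pose b (j : 'I_m) := (perm_nat p 0 < perm_nat p j.+1)%N.
(* If [pi] ranks [0] before [j.+1], a tie counts as the original being below, so the failure of the
   order is a strict inequality. *)
have precE (j : 'I_m) w t : ~~ prec_pi (Sstat k (fun i => X i w) al t) (perm_nat p) 0 j.+1 =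
    (if b j then S j.+1 w t - S 0 w t < 0 else S j.+1 w t - S 0 w t <= 0).
  rewrite /prec_pi -/(b j) -/(S 0 w t) -/(S j.+1 w t) subr_lt0 subr_le0.
  by case: ifP => _; rewrite ?andbT ?andbF ?orbF -?le_eqVlt ?leNgt// orbC -le_eqVlt -ltNge.
rewrite (_ : [set w | _] = \bigcup_(A in [set A : {set 'I_m} | (1 + #|~: A| <= J)%N])
    [set w | exists t, c < t /\ forall j : 'I_m, j \in A ->
      if b j then S j.+1 w t - S 0 w t < 0 else S j.+1 w t - S 0 w t <= 0]).
  apply: fin_bigcup_measurable => [|A _]; first exact: finite_finset.
  apply: (@measurable_exists_lipschitz _ _ _ _ A b (fun j w t => S j.+1 w t - S 0 w t) 2) => //.
    by move=> j t; apply: measurable_funB; exact: measurable_Sstat.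
  move=> j w t t'; have := Sstat_lipschitz kn (fun i => X i w) al j.+1 t t'.
  have := Sstat_lipschitz kn (fun i => X i w) al 0 t' t; rewrite distrC /S; lra.
have rankE w t : rankR k (fun i => X i w) al p t =
    (1 + #|[set j : 'I_m | prec_pi (Sstat k (fun i => X i w) al t) (perm_nat p) 0 j.+1]%SET|)%N.
  rewrite /rankR big_add1 big_mkord /= -sum1dep_card; congr addn.
  by rewrite [RHS]big_mkcond; apply: eq_bigr => j _; case: prec_pi.
apply/seteqP; split => w /=.
  move=> [t [ct h]]; exists [set j : 'I_m | ~~ prec_pi (Sstat k (fun i => X i w) al t) (perm_nat p) 0 j.+1]%SET.
    rewrite /=; move: h; rewrite rankE; congr (is_true (1 + _ <= J)%N).
    by apply: eq_card => j; rewrite !inE negbK.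
  by exists t; split=> // j; rewrite inE precE.
move=> [A /= AJ [t [ct h]]]; exists t; split=> //; rewrite rankE; apply: leq_trans AJ.
rewrite leq_add2l subset_leq_card//; apply/fintype.subsetP => j; rewrite !inE.
by apply: contraL => /h; rewrite -precE.
Qed.

Lemma rankR_ext (x : 'I_n -> R) (al al' : 'I_n -> nat -> bool) m (p : {perm 'I_m.+1}) t :
  (forall i (j : 'I_m), al i j.+1 = al' i j.+1) ->
  rankR k x al p t = rankR k x al' p t.
Proof.
move=> alE; rewrite /rankR !big_add1 !big_mkord; congr addn; apply: eq_bigr => j _.
have SE (j' : nat) : (forall i, resign R al j' i = resign R al' j' i) ->
    Sstat k x al t j' = Sstat k x al' t j'.
  move=> rE; rewrite !Sstat_median//; congr median; apply: eq_map => l.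
  by congr (_ / _); apply: eq_bigr => i _; rewrite rE.
by rewrite /prec_pi !SE// => i; rewrite /resign /= alE.
Qed.

(** As the inequality is strict, a member of the set witnesses it even when the supremum is not
    attained. *)
Lemma upper_bound_gtP m r (x : 'I_n -> R) al (p : {perm 'I_m}) (c : R) :
  (c%:E < upper_bound k r x al p)%E <-> exists t, c < t /\ (rankR k x al p t <= m - r)%N.
Proof.
split=> [/ereal_sup_gt[_ [t ht <-]]|[t [ct ht]]]; first by rewrite lte_fin; exists t.
by apply: (@lt_le_trans _ _ t%:E); [rewrite lte_fin|apply: ereal_sup_ubound; exists t].
Qed.

End RankEvent.

(** * Union bound, symmetry and the moment condition *)

Section Moments.
Context d (T : measurableType d) (R : realType) (P : probability T R).

Lemma measure_le_sum (I : finType) (Q : pred I) (A : set T) (F : I -> set T) :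
  measurable A -> (forall i, measurable (F i)) ->
  (forall w, A w -> exists2 i, Q i & F i w) ->
  (P A <= \sum_(i | Q i) P (F i))%E.
Proof.
move=> mA mF AF.
have [mU hU] : measurable (\big[setU/set0]_(i | Q i) F i) /\
    (P (\big[setU/set0]_(i | Q i) F i) <= \sum_(i | Q i) P (F i))%E.
  elim/big_rec2: _ => [|i s B Qi [mB hB]]; first by rewrite measure0.
  split; first exact: measurableU.
  by apply: le_trans (measureU2 _ _ _) _ => //; rewrite leeD2l.
apply: le_trans hU; apply: le_measure; rewrite ?inE// => w /AF[i Qi Fi].
by rewrite (bigD1 i)//=; left.
Qed.

(** [X] and [2 mu - X] have the same integral. This recentres the moment hypothesis, stated at the
    mean, at [mu]. *)
Lemma symmetric_mean (X : T -> R) (mu : R) :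
  measurable_fun setT X -> P.-integrable setT (EFin \o X) ->
  (forall B, measurable B -> P (X @^-1` B) = P ((fun w => 2 * mu - X w) @^-1` B)) ->
  fine (\int[P]_w (X w)%:E)%E = mu.
Proof.
move=> mX iX sX; pose Z w := 2 * mu - X w.
have mZ : measurable_fun setT Z by exact: measurable_funB.
have iZ : P.-integrable setT (EFin \o Z).
  rewrite (_ : EFin \o Z = (cst (2 * mu)%:E \- (EFin \o X))%E); last by apply/funext.
  by apply: integrableB => //; exact: finite_measure_integrable_cst.
have E : (\int[P]_w (X w)%:E = \int[P]_w (Z w)%:E)%E.
  have := @integral_pushforward _ _ T _ R X mX P setT EFin.
  rewrite preimage_setT => /(_ _ iX measurableT) /= <-; last exact: EFin_measurable.
  have := @integral_pushforward _ _ T _ R Z mZ P setT EFin.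
  rewrite preimage_setT => /(_ _ iZ measurableT) /= <-; last exact: EFin_measurable.
  by apply: eq_measure_integral => A mA _; exact: sX.
have EZ : (\int[P]_w (Z w)%:E = (2 * mu)%:E - \int[P]_w (X w)%:E)%E.
  rewrite /Z; under eq_integral do rewrite EFinB.
  rewrite integralB//; last exact: finite_measure_integrable_cst.
  by rewrite integral_cst//= probability_setT mule1.
have : (\int[P]_w (X w)%:E)%E \is a fin_num by exact: integrable_fin_num iX.
move: E; rewrite EZ; case: (\int[P]_w _)%E => // r [] rE _ /=; lra.
Qed.

Lemma symmetric_center (X : T -> R) (mu : R) : 
  (forall B, measurable B -> P (X @^-1` B) = P ((fun w => 2 * mu - X w) @^-1` B)) ->
  forall B, measurable B ->
  P ((fun w => X w - mu) @^-1` B) = P ((fun w => - (X w - mu)) @^-1` B).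
Proof.
move=> sX B mB; pose B' := (fun x : R => x - mu) @^-1` B.
have mB' : measurable B'.
  have msub : measurable_fun setT (fun x : R => x - mu) by exact: measurable_funB.
  by rewrite -[B']setTI; exact: msub.
rewrite -[LHS]/(P (X @^-1` B')) sX//; congr (P _); apply/seteqP; split=> w /=;
  by rewrite /B'/= (_ : 2 * mu - X w - mu = - (X w - mu))//; ring.
Qed.

(** The right side equals [N * (N x)^a], and [N x >= nt x = (12 M)^(1/a)]. This is the condition of
    [integral_trunc_exp_le] on [b = N s], for every block size [N >= nt]. *)
Lemma moment_threshold (a M : R) (N nt : nat) : 0 < a -> 0 <= M -> (0 < nt <= N)%N ->
  12 * M * N%:R <= (N%:R * ((12 * M) `^ (1 / a) / nt%:R) `^ (a / (1 + a))) `^ (1 + a).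
Proof.
move=> a0 M0 /andP[nt0 ntN]; set x := _ / nt%:R.
have ntR0 : 0 < nt%:R :> R by rewrite ltr0n.
have NR0 : 0 < N%:R :> R by rewrite ltr0n (leq_trans nt0).
have x0 : 0 <= x by rewrite divr_ge0// powR_ge0.
have a1 : 1 + a != 0 by apply: lt0r_neq0; lra.
rewrite powRM ?powR_ge0//.
rewrite -powRrM divfK// powRD; last by rewrite (negbTE a1).
rewrite powRr1//.
rewrite -[leRHS]mulrA -powRM//.
rewrite mulrC ler_wpM2l//.
rewrite (_ : 12 * M = ((12 * M) `^ (1 / a)) `^ a); last first.
  by rewrite -powRrM divfK ?gt_eqF// powRr1// mulr_ge0.
have -> : (12 * M) `^ (1 / a) = nt%:R * x by rewrite /x [RHS]mulrC divfK ?gt_eqF.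
apply: ge0_ler_powR; rewrite ?nnegrE ?mulr_ge0 ?(ltW a0)// ?ler_wpM2r ?ler_nat ?powR_ge0//.
Qed.

End Moments.

(** * Counting configurations of signs and permutations *)

Section Configurations.
Variables (R : realType) (n k m : nat).
Hypothesis kn : (0 < k <= n)%N.

(* Joint values of the signs of the [m] resampled copies and of the permutation. *)
Definition config := ({ffun 'I_n * 'I_m -> bool} * {perm 'I_m.+1})%type.

Lemma card_config : #|{: config}| = (2 ^ (n * m) * m.+1`!)%N.
Proof. by rewrite card_prod card_ffun card_bool card_prod !card_ord card_Sn. Qed.

(** Copies are numbered from [1] and the columns of [v.1] from [0], whence [j.-1]; [true] is the
    default past the last copy. At index [0], [resign] sets the sign to [1]. *)
Definition config_sign (v : config) (i : 'I_n) (j : nat) : bool :=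
  if insub j.-1 is Some j' then v.1 (i, j') else true.

Lemma config_signE v i (j : 'I_m) : config_sign v i j.+1 = v.1 (i, j).
Proof. by rewrite /config_sign /= valK. Qed.

Definition unbalanced (j : 'I_m) : {set config} :=
  [set v : config | [exists l : 'I_k, (#|block n l|%:R / 2
     < `|\sum_(i in block n l) sgb R (v.1 (i, j))| :> R)%R]]%SET.

(** Union bound over the [k] blocks. Copy [j] reads the coordinates [(i, j)], so [card_sign_sum_gt]
    is applied to the copy [B l] of the block inside the product index set. *)
Lemma card_unbalanced j :
  #|unbalanced j|%:R <= #|{: config}|%:R * (2 * k%:R * expR (- (n %/ k)%:R / 8)) :> R.
Proof.
pose B (l : 'I_k) := [set (i, j) | i in block n l]%SET.
have cB l : #|B l| = #|block n l| by rewrite card_imset// => x y [].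
pose A l := finset.setX [set v : {ffun 'I_n * 'I_m -> bool} | (#|B l|%:R / 2
  < `|\sum_(i in B l) sgb R (v i)| :> R)%R]%SET [set: {perm 'I_m.+1}]%SET.
have sub : (#|unbalanced j| <= \sum_(l < k) #|A l|)%N.
  rewrite -sum1_card big_mkcond /= (eq_bigr (fun l => \sum_(v : config) (v \in A l))%N).
    rewrite exchange_big; apply: leq_sum => v _; case: ifP => //.
    rewrite inE => /existsP[l hl]; rewrite (bigD1 l)//= (_ : v \in A l) ?leq_addr//.
    by rewrite !inE andbT cB big_imset//= => x y _ _ [].
  by move=> l _; rewrite -sum1_card big_mkcond; apply: eq_bigr => v _; case: ifP.
apply: (@le_trans _ _ (\sum_(l < k) #|A l|%:R)); first by rewrite -natr_sum ler_nat.
apply: (@le_trans _ _ (\sum_(l < k) (2 ^+ (n * m) * (2 * expR (- (n %/ k)%:R / 8)) * (m.+1`!)%:R))).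
  apply: ler_sum => l _; rewrite cardsX natrM cardsT card_Sn ler_wpM2r//.
  apply: le_trans (card_sign_sum_gt R (B l)) _.
  rewrite card_prod !card_ord ler_wpM2l ?exprn_ge0// ler_wpM2l// ler_expR cB.
  by rewrite !mulNr lerN2 ler_wpM2r ?ler_nat ?block_card// invr_ge0.
rewrite sumr_const card_ord card_config natrM natrX -[leLHS]mulr_natr.
by rewrite le_eqVlt; apply/orP; left; apply/eqP; ring.
Qed.

End Configurations.

(** * The deviation bound, by summation over cells of constant signs and permutation *)

Theorem theorem3 (R : realType) (d : measure_display) (T : measurableType d)
  (P : probability T R) (n m k r : nat) (a M mu : R)
  (X : 'I_n -> T -> R) (alpha : 'I_n -> nat -> T -> bool) (pi : T -> {perm 'I_m})
  (* measurability of data, signs alpha_{i,j} (j in [m-1]) and permutation *)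
  (hX : forall i, measurable_fun setT (X i))
  (halpha : forall (i : 'I_n) (j : 'I_m) (b : bool), (0 < j)%N ->
     measurable [set w | alpha i j w = b])
  (hpi : forall p : {perm 'I_m}, measurable [set w | pi w = p])
  (* joint law: X_1..X_n independent, the alpha_{i,j} (i in [n], j in [m-1])
     i.i.d. Rademacher, pi uniform on permutations, all mutually independent *)
  (hjoint : forall (B : 'I_n -> set R) (s : 'I_n -> 'I_m -> bool) (p : {perm 'I_m}),
     (forall i, measurable (B i)) ->
     P [set w | (forall i, B i (X i w)) /\
                (forall (i : 'I_n) (j : 'I_m), (0 < j)%N -> alpha i j w = s i j) /\
                pi w = p]
     = ((\prod_(i < n) P (X i @^-1` B i)) *
        ((2^-1) ^+ (n * m.-1) / (m`!)%:R)%:E)%E)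
  (* identically distributed *)
  (hid : forall (i j : 'I_n) (B : set R), measurable B ->
     P (X i @^-1` B) = P (X j @^-1` B))
  (* common distribution symmetric about mu *)
  (hsym : forall (i : 'I_n) (B : set R), measurable B ->
     P (X i @^-1` B) = P ((fun w => 2 * mu - X i w) @^-1` B))
  (* E|X_1 - E X_1|^(1+a) = M < oo, 0 < a <= 1 *)
  (ha : 0 < a <= 1)
  (hint : forall i : 'I_n, P.-integrable setT (EFin \o X i))
  (hmom : forall i : 'I_n,
     (\int[P]_w (`| X i w - fine (\int[P]_v (X i v)%:E) | `^ (1 + a))%:E)%E = M%:E)
  (hr : (1 <= r <= m)%N) (hk : (1 <= k <= n)%N) :
  let nt := (n %/ k)%N in
  (P [set w | (upper_bound k r (fun i => X i w) (fun i j => alpha i j w) (pi w)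
                > (mu + 4 * ((12 * M) `^ (1 / a) / nt%:R) `^ (a / (1 + a)))%:E)%E]
  <= ((m - r)%:R * (2 * k%:R * expR (- nt%:R / 8) + 2 * expR (- k%:R / 8)))%:E)%E.
Proof.
cbv zeta; set nt := (n %/ k)%N; set s := _ `^ (a / (1 + a)).
case: m pi halpha hpi hjoint hr => [|m'] pi halpha hpi hjoint hr; first by case: r hr.
set J := (m'.+1 - r)%N.
have Jm : (J <= m')%N by case/andP: hr => r1 _; rewrite /J leq_subLR -add1n leq_add2r.
pose V := config n m'.
pose u : R := #|{: V}|%:R^-1.
have V0 : 0 < #|{: V}|%:R :> R by rewrite card_config ltr0n muln_gt0 expn_gt0 fact_gt0.
have u0 : 0 <= u by rewrite invr_ge0 ltW.
have s0 : 0 <= s by exact: powR_ge0.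
have i0 : 'I_n by case/andP: hk => k1 kn; exact: Ordinal (leq_trans k1 kn).
have M0 : 0 <= M by rewrite -lee_fin -(hmom i0); apply: integral_ge0 => w _; rewrite lee_fin powR_ge0.
(* The cells cover the space, and each has probability [u]. Index [j] of ['I_m'] stands for copy
   [j.+1], that is [lift ord0 j]. *)
pose Dv (v : V) := [set w | (forall i (j : 'I_m'), alpha i j.+1 w = v.1 (i, j)) /\ pi w = v.2].
have mD v : measurable (Dv v).
  rewrite (_ : Dv v = (\bigcap_(ij in [set: 'I_n * 'I_m'])
      [set w | alpha ij.1 ij.2.+1 w = v.1 ij]) `&` [set w | pi w = v.2]); last first.
    apply/seteqP; split=> w [h1 h2]; split=> //; first by move=> [i j] _; exact: h1.
    by move=> i j; exact: (h1 (i, j)).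
  apply: measurableI => //; apply: fin_bigcap_measurable => [|[i j] _]; first exact: finite_finset.
  exact: (halpha i (lift ord0 j)).
have hD v (B : 'I_n -> set R) : (forall i, measurable (B i)) ->
    P (Dv v `&` [set w | forall i, B i (X i w)]) = (\prod_(i < n) P (X i @^-1` B i) * u%:E)%E.
  move=> mB; pose sv i (j : 'I_m'.+1) := config_sign v i j.
  have uE : u = (2^-1) ^+ (n * m') / (m'.+1`!)%:R.
    by rewrite /u card_config natrM natrX invfM exprVn.
  rewrite uE -(hjoint B sv v.2 mB); congr (P _); apply/seteqP; split=> w /=.
    move=> [[h1 h2] h3]; split=> //; split=> // i j j0.
    case: (unliftP ord0 j) j0 => [j' ->|->//] _.
    by rewrite /sv lift0 h1 config_signE.
  move=> [h3 [h1 h2]]; split=> //; split=> // i j.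
  by have := h1 i (lift ord0 j) isT; rewrite /sv lift0 config_signE.
have PD v : P (Dv v) = u%:E.
  have := hD v (fun=> setT) (fun=> measurableT).
  rewrite big1 ?mul1e => [<-|i _]; last by rewrite preimage_setT probability_setT.
  by congr (P _); apply/seteqP; split=> w // [].
have hE i tau (N := #|block n (block_of hk i)|) :
    (\int[P]_w (trunc_exp tau (N%:R * s) (X i w - mu))%:E <= (1 + 3 / (40 * N%:R))%:E)%E.
  have ntN : (0 < nt <= N)%N by rewrite block_card// andbT divn_gt0; have /andP[] := hk.
  apply: (@integral_trunc_exp_le _ _ _ P _ a M) => //.
  - exact: measurable_funB.
  - exact: (symmetric_center (hsym i)).
  - by rewrite -(hmom i) (symmetric_mean (hX i) (hint i) (hsym i)).
  - by rewrite mulr_ge0.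
  - by case/andP: ntN => /leq_trans h /h.
  - by apply: moment_threshold => //; case/andP: ha.
pose cnt (c : 'I_n -> bool) := [set w | (k <= 2 * #|[set l : 'I_k | (#|block n l|%:R * s <
     \sum_(i in block n l) sgb R (c i) * (X i w - mu))%R]%SET|)%N].
have mcnt c : measurable (cnt c) by exact: measurable_block_count.
have Pcnt v c : (P (Dv v `&` cnt c) <= (u * expR (- k%:R / 8))%:E)%E.
  exact: (@block_count_tail _ _ _ P _ _ hk _ hX _ _ _ _ _ (mD v) u0 s0 (hD v) hE).
set Ev := [set w | _].
pose Rv (v : V) := [set w | exists t, mu + 4 * s < t /\
  (rankR k (fun i => X i w) (config_sign v) v.2 t <= J)%N].
(* On a cell the rank is that of a constant configuration, which makes the event measurable cell by
   cell. *)
have EvD v : Ev `&` Dv v = Dv v `&` Rv v.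
  have E w t : Dv v w -> rankR k (fun i => X i w) (fun i j => alpha i j w) (pi w) t =
      rankR k (fun i => X i w) (config_sign v) v.2 t.
    by move=> [h1 ->]; apply: rankR_ext => // i j; rewrite h1 config_signE.
  apply/seteqP; split=> w [].
    by move=> /upper_bound_gtP[t [ct ht]] Dw; split=> //; exists t; rewrite -E.
  by move=> Dw [t [ct ht]]; split=> //; apply/upper_bound_gtP; exists t; rewrite E.
have mEvD v : measurable (Ev `&` Dv v).
  by rewrite EvD; apply: measurableI => //; exact: measurable_exists_rank_le.
pose cfg (w : T) : V := ([ffun ij : 'I_n * 'I_m' => alpha ij.1 ij.2.+1 w], pi w).
have Dcfg w : Dv (cfg w) w by split=> // i j; rewrite ffunE.
have mEv : measurable Ev.
  rewrite (_ : Ev = \bigcup_(v in [set: V]) (Ev `&` Dv v)).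
    by apply: fin_bigcup_measurable => [|v _]; [exact: finite_finset|exact: mEvD].
  by apply/seteqP; split=> w; [move=> Ew; exists (cfg w)|case=> v _ []].
(* The charge to copy [j] in cell [v]: the whole mass of the cell if its signs are unbalanced, plus
   the two block tails. *)
pose g (v : V) (j : 'I_m') : R := (v \in unbalanced R n k j)%:R * u + 2 * (u * expR (- k%:R / 8)).
have bound v : (P (Ev `&` Dv v) <= (\sum_(j < m' | (j < J)%N) g v j)%:E)%E.
  have e0 : 0 <= u * expR (- k%:R / 8) by rewrite mulr_ge0// expR_ge0.
  have g0 j : 0 <= g v j by rewrite addr_ge0// mulr_ge0.
  have [/existsP[j /andP[jJ hj]]|] := boolP [exists j : 'I_m', (j < J)%N && (v \in unbalanced R n k j)].
    apply: (@le_trans _ _ (P (Dv v))); first by apply: le_measure; rewrite ?inE// => w [].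
    rewrite PD lee_fin (bigD1 j)//= {1}/g hj mul1r -addrA lerDl addr_ge0//.
      by rewrite mulr_ge0.
    by rewrite sumr_ge0.
  rewrite negb_exists => /forallP bal.
  (* With balanced signs, the two events left by [Sstat_le_blocks]: large block sums of the centred
     data, and of the same data with the negated signs of copy [j]. *)
  pose F (j : 'I_m') := (Dv v `&` cnt (fun=> true)) `|` (Dv v `&` cnt (fun i => ~~ v.1 (i, j))).
  have mF j : measurable (F j) by apply: measurableU; apply: measurableI.
  apply: (@le_trans _ _ (\sum_(j < m' | (j < J)%N) P (F j))%E).
    apply: measure_le_sum => // w; rewrite EvD => -[Dw [t [ct ht]]].
    have [j jJ hprec] := rankR_ge Jm ht; exists j => //.
    have balj : forall l : 'I_k, `|\sum_(i in block n l) resign R (config_sign v) j.+1 i|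
        <= #|block n l|%:R / 2.
      have := bal j; rewrite jJ inE negb_exists => /forallP h l; have := h l.
      rewrite -leNgt; congr (`|_| <= _); apply: eq_bigr => i _.
      by rewrite /resign /= config_signE.
    have S_le : Sstat k (fun i => X i w) (config_sign v) t j.+1
        <= Sstat k (fun i => X i w) (config_sign v) t 0.
      by rewrite leNgt; apply: contra hprec; rewrite /prec_pi => ->.
    have [h|h] := Sstat_le_blocks hk s0 ct balj S_le; [left|right]; split=> //=.
      rewrite /cnt/=; congr (is_true (k <= 2 * _)%N): h; apply: eq_card => l; rewrite !inE.
      by congr (_ < _); apply: eq_bigr => i _; rewrite /sgb mul1r.
    rewrite /cnt/=; congr (is_true (k <= 2 * _)%N): h; apply: eq_card => l; rewrite !inE.
    congr (_ < _); apply: eq_bigr => i _; rewrite /resign /= config_signE.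
    by case: (v.1 _); rewrite /sgb /= ?opprK.
  rewrite -sumEFin; apply: lee_sum => j _.
  apply: (@le_trans _ _ (P (Dv v `&` cnt (fun=> true)) + P (Dv v `&` cnt (fun i => ~~ v.1 (i, j))))%E).
    by apply: measureU2; apply: measurableI.
  apply: le_trans (leeD (Pcnt _ _) (Pcnt _ _)) _.
  by rewrite -EFinD lee_fin /g -[leLHS]mulr2n -[leLHS]mulr_natl lerDr mulr_ge0.
apply: (@le_trans _ _ (\sum_(v : V) P (Ev `&` Dv v))%E).
  by apply: measure_le_sum => // w Ew; exists (cfg w).
apply: (@le_trans _ _ (\sum_(v : V) (\sum_(j < m' | (j < J)%N) g v j)%:E)%E).
  by apply: lee_sum => v _; exact: bound.
rewrite sumEFin lee_fin exchange_big/=.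
have cJ : #|[pred j : 'I_m' | (j < J)%N]| = J.
  by rewrite -sum1_card -(big_ord_widen m' (fun=> 1)%N Jm) sum1_card card_ord.
apply: (@le_trans _ _ (\sum_(j < m' | (j < J)%N)
    (2 * k%:R * expR (- nt%:R / 8) + 2 * expR (- k%:R / 8)))); last first.
  by rewrite sumr_const cJ -[leLHS]mulr_natl.
(* Summed over the cells, the first term is the proportion of unbalanced configurations, and the
   second loses its [u] because the cells have total mass [1]. *)
apply: ler_sum => j _; rewrite /g big_split/= -mulr_suml sumr_const.
rewrite -natr_sum -big_mkcond/= sum1_card lerD//.
  rewrite ler_pdivrMr// mulrC; exact: card_unbalanced.
have uV : u * #|{: V}|%:R = 1 by rewrite /u mulVf// lt0r_neq0.
rewrite -[leLHS]mulr_natr -mulrA -mulrA ler_wpM2l// mulrCA.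
by rewrite uV mulr1.
Qed.
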